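(* Consider a real scalar field of mass $m\ll H$ in the Bunch--Davies vacuum in the cosmological patch of de Sitter spacetime with Hubble rate $H$, and let $A$ and $B$ be any two non-overlapping single-mode subsystems compactly supported in super-Hubble regions, i.e. $RH\gg1$. Then the entanglement between $A$ and $B$, as quantified by the logarithmic negativity, decreases monotonically with $H$. That is, for fixed smearing functions and fixed sufficiently small $\mu^2>0$, there is $H_0>0$ such that $H\mapsto\mathrm{LN}(\hat\rho_{AB})$ is non-increasing on $[H_0,\infty)$.
   Context: Units $\hbar=c=1$. Fourier transform $\tilde h(\vec k)=\int d^3x\,h(\vec x)e^{i\vec k\cdot\vec x}$; Sobolev product of order $s$: $(f,g)_s=\int\frac{d^3k}{(2\pi)^3}|\vec k|^{2s}\tilde f(\vec k)\tilde g^*(\vec k)$. Setting. The cosmological patch of de Sitter space has metric $ds^2=a^2(\eta)(-d\eta^2+d\vec x^2)$, $a=-1/(H\eta)$, $\eta<0$. For a Klein--Gordon field of mass $m$ put $\mu^2=\frac32-\sqrt{\frac94-\frac{m^2}{H^2}}$. The Bunch--Davies vacuum is the zero-mean pure Gaussian state annihilated by the operators multiplying the modes $\sqrt{-\pi\eta/(4a^2)}\,H^{(1)}_{3/2-\mu^2}(-k\eta)e^{i\vec k\cdot\vec x}$. The operators $\hat\Phi=\hat\phi$ and $\hat\Pi=a^2\partial_\eta\hat\phi$ are taken at the time when $a=1$. Phase space and observables. Elements $\gamma=(g,f)$ are pairs of real functions with $g\in\dot H_{1/2}(\mathbb R^3)$, $f\in\dot H_{-1/2}(\mathbb R^3)$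 (homogeneous Sobolev spaces) and symplectic form $\omega(\gamma_1,\gamma_2)=\int d^3x(f_1g_2-g_1f_2)$; to $\gamma$ corresponds the operator $\hat O_\gamma=\hat\Phi(f)-\hat\Pi(g)$. The covariance metric of the state is $\sigma(\gamma,\gamma')=\langle\{\hat O_\gamma,\hat O_{\gamma'}\}\rangle$. Regime. In the regime $\mu^2\ll1$, terms of order $\mathcal O(\mu^2)$ are neglected, and the covariance metric of the Bunch--Davies vacuum is given by its leading-order form $$\sigma(\gamma,\gamma')=\mathrm{Re}(g,g')_{\frac12}+\mathrm{Re}(f,f')_{-\frac12}+\kappa^2H^{2-2\mu^2}\mathrm{Re}(f,f')_{-\frac32+\mu^2}-\kappa H^{1-\mu^2}\left[\mathrm{Re}(f,g')_{-\frac{1-\mu^2}2}+\mathrm{Re}(f',g)_{-\frac{1-\mu^2}2}\right],$$ $$\kappa=\frac{2^{1-\mu^2}\sqrt\pi}{\cos(\pi\mu^2)\,\Gamma(-\frac12+\mu^2)}.$$ $R$ denotes the characteristic radius of the supports of the modes; it is fixed when $H$ varies. Single-mode subsystems. $I\in\{A,B\}$ is given by a symplectic subspace $\Gamma_I=\mathrm{span}[\gamma_I^{(1)},\gamma_I^{(2)}]$ with $\gamma_I^{(i)}=(g_I^{(i)},f_I^{(i)})$ compactly supported and $\omega(\gamma_I^{(2)},\gamma_I^{(1)})=1$; non-overlapping means that the supports of the functions of $A$ are disjoint from those of $B$. Logarithmic negativity. Let $\sigma_{AB}=\begin{pmatrix}\sigma_A&C\\C^T&\sigma_B\end{pmatrix}$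 be the $4\times4$ matrix of $\sigma$ in the basis $(\gamma_A^{(1)},\gamma_A^{(2)},\gamma_B^{(1)},\gamma_B^{(2)})$, $\tilde\Delta=\det\sigma_A+\det\sigma_B-2\det C$ and $\tilde\nu_-^2=\frac12\left(\tilde\Delta-\sqrt{\tilde\Delta^2-4\det\sigma_{AB}}\right)$. Then $\mathrm{LN}(\hat\rho_{AB})=\max\{0,-\log_2\tilde\nu_-\}$; it is non-zero if and only if $A$ and $B$ are entangled. *)

(* Defs.v *)
From mathcomp Require Import all_boot all_order all_algebra.
From mathcomp Require Import all_classical all_reals all_analysis.
From mathcomp.real_closed Require Import complex.
Import Order.TTheory GRing.Theory Num.Theory.
Import numFieldNormedType.Exports.

Set Implicit Arguments.
Unset Strict Implicit.
Unset Printing Implicit Defensive.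

Local Open Scope classical_set_scope.
Local Open Scope complex_scope.
Local Open Scope ring_scope.

Notation space R := (R * R * R)%type.

Section Space.
Variable R : realType.
Implicit Types (h : space R -> R) (x k : space R) (s : R).

Definition vol : {measure set (space (measurableTypeR R)) -> \bar R} :=
  ((@lebesgue_measure R \x @lebesgue_measure R) \x @lebesgue_measure R)%E.

Definition dot x k : R := x.1.1 * k.1.1 + x.1.2 * k.1.2 + x.2 * k.2.

(* The norm that the library puts on a product is the sup norm. *)
Definition euclid_norm k : R := Num.sqrt (dot k k).

Definition Cintegral (F : space R -> R[i]) : R[i] :=
  Rintegral vol setT (fun x => complex.Re (F x))
  +i* Rintegral vol setT (fun x => complex.Im (F x)).

Definition expi (t : R) : R[i] := cos t +i* sin t.

Definition fourier h k : R[i] :=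
  Cintegral (fun x => (h x)%:C * expi (dot k x)).

Definition sobolev_density s h1 h2 k : R[i] :=
  (euclid_norm k `^ (2 * s) / (2 * pi) ^+ 3)%:C
  * fourier h1 k * conjc (fourier h2 k).

Definition sobolev_prod s h1 h2 : R[i] := Cintegral (sobolev_density s h1 h2).

(* Membership in the homogeneous Sobolev space of order s, for functions whose
   Fourier transform is given by an absolutely convergent integral.  This covers
   every compactly supported element given by a locally integrable function. *)
Definition homogeneous_sobolev s h : Prop :=
  vol.-integrable setT (EFin \o h) /\
  vol.-integrable setT (EFin \o (fun k => complex.Re (sobolev_density s h h k))).

Definition supp h : set (space R) := closure [set x | h x != 0].

End Space.

Section PhaseSpace.
Variable R : realType.

Record observable := Observable {
  obs_g : space R -> R;
  obs_f : space R -> R }.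

Definition in_phase_space (c : observable) : Prop :=
  homogeneous_sobolev (1 / 2) (obs_g c) /\
  homogeneous_sobolev (- (1 / 2)) (obs_f c).

(* Rintegral is 0 on functions whose integral is infinite or undefined, so
   omega c c' = 1 forces the integrand to be absolutely integrable. *)
Definition omega (c c' : observable) : R :=
  Rintegral (@vol R) setT
    (fun x => obs_f c x * obs_g c' x - obs_g c x * obs_f c' x).

(* A mode is given by its generators: index ord0 is the first, ord_max the
   second. *)
Definition single_mode (G : 'I_2 -> observable) : Prop :=
  [/\ forall i, in_phase_space (G i),
      forall i, compact (supp (obs_g (G i))) /\ compact (supp (obs_f (G i)))
    & omega (G ord_max) (G ord0) = 1].

Definition region (G : 'I_2 -> observable) : set (space R) :=
  \bigcup_i (supp (obs_g (G i)) `|` supp (obs_f (G i))).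

Definition non_overlapping (A B : 'I_2 -> observable) : Prop :=
  region A `&` region B = set0.

End PhaseSpace.

Section BunchDavies.
Variable R : realType.

Definition euler_integral (x : R) : R :=
  Rintegral (@lebesgue_measure R) `]0, +oo[ (fun t => t `^ (x - 1) * expR (- t)).

(* Euler's integral converges for positive arguments only; the functional
   equation Gamma (x + 1) = x * Gamma x, used n times with x + n > 0, extends it
   to all x outside {0, -1, -2, ...}. *)
Definition Gamma (x : R) : R :=
  let n := (Num.truncn `|x|).+1 in
  euler_integral (x + n%:R) / \prod_(i < n) (x + i%:R).

(* This is the quantity mu ^ 2. *)
Definition musq (m H : R) : R :=
  3 / 2 - Num.sqrt (9 / 4 - m ^+ 2 / H ^+ 2).

Definition kappa (mu2 : R) : R :=
  2 `^ (1 - mu2) * Num.sqrt pi / (cos (pi * mu2) * Gamma (- (1 / 2) + mu2)).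

(* Covariance metric of the Bunch-Davies vacuum of the field of mass m at Hubble
   rate H, at leading order for musq m H << 1. *)
Definition BD_covariance (m H : R) (c c' : observable R) : R :=
  let mu2 := musq m H in
  let g := obs_g c in let f := obs_f c in
  let g' := obs_g c' in let f' := obs_f c' in
  complex.Re (sobolev_prod (1 / 2) g g')
  + complex.Re (sobolev_prod (- (1 / 2)) f f')
  + kappa mu2 ^+ 2 * H `^ (2 - 2 * mu2)
    * complex.Re (sobolev_prod (- (3 / 2) + mu2) f f')
  - kappa mu2 * H `^ (1 - mu2)
    * (complex.Re (sobolev_prod (- ((1 - mu2) / 2)) f g')
       + complex.Re (sobolev_prod (- ((1 - mu2) / 2)) f' g)).

End BunchDavies.

Section Negativity.
Variable R : realType.
Variable sigma : observable R -> observable R -> R.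

Definition cov_mx (A B : 'I_2 -> observable R) : 'M[R]_2 :=
  \matrix_(i, j) sigma (A i) (B j).

Definition log2 (x : R) : R := ln x / ln 2.

Definition log_negativity (A B : 'I_2 -> observable R) : R :=
  let sA := cov_mx A A in
  let sB := cov_mx B B in
  let C := cov_mx A B in
  let detAB := \det (block_mx sA C C^T sB) in
  let Delta := \det sA + \det sB - 2 * \det C in
  let nu2 := (Delta - Num.sqrt (Delta ^+ 2 - 4 * detAB)) / 2 in
  Num.max 0 (- log2 (Num.sqrt nu2)).

End Negativity.

(* Main.v *)
(* In momentum space the covariance metric is
     sigma(c, c) = || G c - q F c ||^2 + || E c ||^2,    q = kappa H^(1 - nu),
   with [nu] the paper's mu^2, [G c = |k|^(1/2) g~], [E c = |k|^(-1/2) f~] and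
   [F c = |k|^(-3/2 + nu) f~], so all its entries are polynomials in [q].  The
   logarithmic negativity vanishes as soon as [2 <= D] and [D - 1 <= det sigma],
   where [D = det sigma_A + det sigma_B - 2 det C], and both inequalities hold
   for large [|q|]: after a unimodular change of generators inside each mode,
   every generator has either [f = 0], and a leading vector [G c], or [f]
   independent of the others, and a leading vector [q F c].  The four leading
   vectors are linearly independent.  Indeed a relation between them reads
   [f~ = - |k|^(2 - nu) g~] with [f] and [g] compactly supported; along each ray
   both transforms are entire, hence vanish at 0 to an integer order or
   identically, and [2 - nu] is not an integer; so [f = g = 0] almost
   everywhere, against the disjointness of the supports and
   [omega c2 c1 = 1].  The rescaled covariance matrix thus tends to a positive
   definite Gram matrix, which gives [det sigma >> D >> 1].  If [kappa = 0], the
   covariance does not depend on [H] at all. *)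

(* Unless [kappa = 0], the negativity is constant beyond some [H0] because it is zero there, so the
   whole task is to reach the two inequalities. Two obstacles shape the argument. Generators of one
   mode may grow at different rates, so no single power of [q] normalises the covariance; and the
   term [- 2 * det C] in [D] could cancel the two positive ones. Giving each generator its own power
   of [p = 1 / q] settles both: up to a positive factor, [D] is a quadratic form in the scaling
   factors, whose coefficients tend to Gram determinants, and the strict inequality
   [det C ^ 2 < det A * det B] for these limits makes it positive definite. Punctured neighbourhoods
   of [p = 0] treat both signs of [kappa] at once. The other analytic input, that an integrable
   function supported in a cube with zero Fourier transform vanishes almost everywhere, is obtained
   without an inversion formula: multiplication by the indicator of any measurable set turns out to
   preserve the vanishing of the transform. *)
Require Import Defs.
From HB Require Import structures.
From mathcomp Require Import all_boot all_order all_algebra.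
From mathcomp Require Import all_classical all_reals all_analysis.
From mathcomp Require Import measurable_realfun ring lra.
From mathcomp.real_closed Require Import complex.
Import Order.TTheory GRing.Theory Num.Theory.
Import numFieldNormedType.Exports.

Set Implicit Arguments.
Unset Strict Implicit.
Unset Printing Implicit Defensive.

Local Open Scope classical_set_scope.
Local Open Scope ring_scope.

(** * Symplectic eigenvalues of the partial transpose *)

Section PosDef.
Variable R : realType.
Implicit Types (A B C : 'M[R]_2).

Lemma det2E A : \det A = A 0 0 * A 1 1 - A 0 1 * A 1 0.
Proof.
rewrite (expand_det_row _ 0) !big_ord_recl big_ord0 addr0 /cofactor /=.
rewrite !det_mx11 !mxE /= expr0 expr1 mul1r mulN1r mulrN.
by congr (_ * A _ _ - A _ _ * A _ _); apply/val_inj.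
Qed.

Lemma det_block_schur A B C : \det A != 0 ->
  \det (block_mx A C C^T B) = \det A * \det (B - C^T *m invmx A *m C).
Proof.
move=> A0; have uA : A \in unitmx by rewrite unitmxE unitfE.
set S := B - _; rewrite -(det_ublock A C S).
have -> : block_mx A C C^T B =
    block_mx 1%:M 0 (C^T *m invmx A) 1%:M *m block_mx A C 0 S.
  rewrite mulmx_block !mul1mx !mul0mx ?mulmx0 !addr0 mulmxKV //.
  by rewrite /S addrC subrK.
by rewrite det_mulmx det_lblock !det1 !mul1r.
Qed.

(** The test vector [(1, 0)] yields [A 0 0], and [(- A 0 1, A 0 0)] yields [A 0 0 * \det A]. *)
Lemma quad2_pos A : A^T = A -> (forall x : 'rV[R]_2, x != 0 -> 0 < (x *m A *m x^T) 0 0) ->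
  0 < A 0 0 /\ 0 < \det A.
Proof.
move=> sA pA.
have s01 : A 1 0 = A 0 1 by rewrite -[in LHS]sA mxE.
have qE (x : 'rV[R]_2) : (x *m A *m x^T) 0 0 =
    x 0 0 ^+ 2 * A 0 0 + 2 * x 0 0 * x 0 1 * A 0 1 + x 0 1 ^+ 2 * A 1 1.
  rewrite !mxE !big_ord_recl big_ord0 !mxE !big_ord_recl !big_ord0.
  have -> : lift ord0 ord0 = 1 :> 'I_2 by apply/val_inj.
  rewrite s01; ring.
pose v (a b : R) : 'rV[R]_2 := \row_(j < 2) (if j == 0 then a else b).
have a0 : 0 < A 0 0.
  have := pA (v 1 0); rewrite qE !mxE /= => /(_ _).
  rewrite !mulr0 mul0r expr0n /= mul0r !addr0 expr1n mul1r; apply.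
  by apply/eqP => /rowP/(_ 0); rewrite !mxE /= => /eqP; rewrite oner_eq0.
split=> //.
have := pA (v (- A 0 1) (A 0 0)); rewrite qE !mxE /= => /(_ _) h.
rewrite det2E s01.
suff : 0 < A 0 0 * (A 0 0 * A 1 1 - A 0 1 * A 0 1) by rewrite pmulr_rgt0.
apply: lt_le_trans (h _) _; last by rewrite le_eqVlt; apply/orP; left; apply/eqP; ring.
apply/eqP => /rowP/(_ 1); rewrite !mxE /= => /eqP; by rewrite gt_eqF.
Qed.

Lemma quad2_ge0_det A : A^T = A -> (forall x : 'rV[R]_2, 0 <= (x *m A *m x^T) 0 0) ->
  0 <= A 0 0 /\ 0 <= A 1 1.
Proof.
move=> sA pA; split.
  have := pA (delta_mx 0 0); rewrite -rowE trmx_delta -colE !mxE //.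
have := pA (delta_mx 0 1); rewrite -rowE trmx_delta -colE !mxE //.
Qed.

(** The difference of the two sides is the mixed term in the expansion of [\det (S + T)], so this
    gives [\det S + \det T <= \det (S + T)]. It holds because the difference of the squares is a sum
    of non-negative terms, one for each determinant and one perfect square. *)
Lemma mixed_det_ge (s00 s01 s11 t00 t01 t11 : R) :
    0 < s00 -> 0 < s11 -> 0 <= t00 -> 0 <= t11 ->
    0 < s00 * s11 - s01 * s01 -> 0 <= t00 * t11 - t01 * t01 ->
  2 * s01 * t01 <= s00 * t11 + s11 * t00.
Proof.
move=> s0 s1 t0 t1 ds dt; set X := s00 * t11 + s11 * t00.
have X0 : 0 <= X by rewrite addr_ge0 // mulr_ge0 // ltW.
apply: le_trans (ler_norm _) _; rewrite -(ger0_norm X0) -ler_sqr ?nnegrE //.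
rewrite !real_normK ?num_real // -subr_ge0.
have -> : X ^+ 2 - (2 * s01 * t01) ^+ 2 = (s00 * t11 - s11 * t00) ^+ 2
   + 4 * ((s00 * s11 - s01 * s01) * (t00 * t11)
   + s01 ^+ 2 * (t00 * t11 - t01 * t01)) by rewrite /X; ring.
apply: addr_ge0; first exact: sqr_ge0.
apply: mulr_ge0 => //; apply: addr_ge0; apply: mulr_ge0 => //.
- exact: ltW.
- exact: mulr_ge0.
- exact: sqr_ge0.
Qed.

(* [B = S + T] with the Schur complement [S] positive definite and
   [T = C^T A^-1 C] semidefinite, so [\det B > \det T = \det C ^+ 2 / \det A]. *)
Lemma posdef_block_det A B C : A^T = A -> B^T = B ->
    (forall x y : 'rV[R]_2, (x != 0) || (y != 0) ->
      0 < (row_mx x y *m block_mx A C C^T B *m (row_mx x y)^T) 0 0) ->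
  [/\ 0 < \det A, 0 < \det B, \det C ^+ 2 < \det A * \det B
    & 0 < \det (block_mx A C C^T B)].
Proof.
move=> sA sB pN.
have E x y : row_mx x y *m block_mx A C C^T B *m (row_mx x y)^T =
    x *m A *m x^T + y *m C^T *m x^T + x *m C *m y^T + y *m B *m y^T :> 'M[R]_1.
  by rewrite mul_row_block tr_row_mx mul_row_col !mulmxDl !addrA.
have [a0 dA] : 0 < A 0 0 /\ 0 < \det A.
  apply: quad2_pos => // x x0; have := pN x 0; rewrite x0 E => /(_ isT).
  by rewrite trmx0 !mul0mx !mulmx0 !addr0.
have [b0 dB] : 0 < B 0 0 /\ 0 < \det B.
  apply: quad2_pos => // x x0; have := pN 0 x; rewrite x0 orbT E => /(_ isT).
  by rewrite trmx0 !mul0mx !mulmx0 !add0r.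
have uA : A \in unitmx by rewrite unitmxE unitfE gt_eqF.
pose Tm := C^T *m invmx A *m C; pose S := B - Tm.
have sT : Tm^T = Tm by rewrite /Tm !trmx_mul trmxK trmx_inv sA mulmxA.
have sS : S^T = S by rewrite /S linearB /= sB sT.
have [s0 dS] : 0 < S 0 0 /\ 0 < \det S.
  (* For fixed [y] this first component minimises the form, and the minimum is [y *m S *m y^T]. *)
  apply: quad2_pos => // y y0; have := pN (- (y *m C^T *m invmx A)) y.
  rewrite y0 orbT E => /(_ isT).
  rewrite !mulNmx linearN /= !mulmxN mulmxKV // opprK.
  rewrite subrr add0r /S mulmxBr mulmxBl /Tm !mulmxA.
  by rewrite addrC.
have tge (x : 'rV[R]_2) : 0 <= (x *m Tm *m x^T) 0 0.
  have -> : x *m Tm *m x^T = (x *m C^T *m invmx A) *m A *m (x *m C^T *m invmx A)^T.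
    by rewrite !trmx_mul trmxK trmx_inv sA mulmxKV // /Tm !mulmxA.
  set z := x *m _ *m _; have [->|z0] := eqVneq z 0; first by rewrite !mul0mx mxE.
  by have := pN z 0; rewrite z0 E trmx0 !mul0mx !mulmx0 !addr0 => /(_ isT)/ltW.
have [t0 t1] := quad2_ge0_det sT tge.
have dT : \det Tm = \det C ^+ 2 / \det A.
  by rewrite /Tm !det_mulmx det_tr det_inv expr2; ring.
have dT0 : 0 <= \det Tm by rewrite dT divr_ge0 ?sqr_ge0 // ltW.
split=> //; last by rewrite det_block_schur ?gt_eqF // mulr_gt0.
rewrite mulrC -ltr_pdivrMr // -dT.
have -> : B = S + Tm by rewrite /S subrK.
move: dS dT0 s0 t0 t1; rewrite !det2E !mxE.
have := congr1 (fun M : 'M[R]_2 => M 1 0) sT; have := congr1 (fun M : 'M[R]_2 => M 1 0) sS.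
rewrite !mxE => <- <-.
set s00 := B 0 0 - _; set s01 := B 0 1 - _; set s11 := B 1 1 - _.
set t00 := Tm 0 0; set t01 := Tm 0 1; set t11 := Tm 1 1 => dS dT0 s0 t0 t1.
have s11_0 : 0 < s11.
  by rewrite -(pmulr_rgt0 _ s0); apply: le_lt_trans (_ : s01 * s01 < _);
     rewrite -?expr2 ?sqr_ge0 // expr2 -subr_gt0.
have := mixed_det_ge s0 s11_0 t0 t1 dS dT0.
by move: dS; nra.
Qed.

End PosDef.

(** * Determinants of covariance matrices whose generators diverge at different rates *)

Section Asymptotics.
Variables (R : realType) (T : Type) (F : set_system T).
Context {FF : Filter F}.

Let cvgX (f : T -> R) (l : R) n :
  f x @[x --> F] --> l -> f x ^+ n @[x --> F] --> l ^+ n.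
Proof.
move=> fl; elim: n => [|n IHn]; first by rewrite expr0; exact: cvg_cst.
by under eq_fun do rewrite exprS; rewrite exprS; exact: cvgM.
Qed.

Lemma cvg_det n (M : T -> 'M[R]_n) (N : 'M[R]_n) :
  (forall i j, M x i j @[x --> F] --> N i j) -> \det (M x) @[x --> F] --> \det N.
Proof.
move=> MN; rewrite /determinant; apply: cvg_big => [|s _].
  exact: (@add_continuous R).
apply: cvgM; first exact: cvg_cst.
apply: cvg_big => [|i _]; last exact: MN.
exact: (@mul_continuous R).
Qed.

(** A congruence by diagonal matrices: in the application the exponent is 1 for a generator of size
    [1 / p] and 0 for a bounded one. *)
Definition scale_mx (p : R) (e e' : 'I_2 -> nat) (M : 'M[R]_2) : 'M[R]_2 :=
  \matrix_(i, j) (p ^+ e i * p ^+ e' j * M i j).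

Let dg (p : R) (e : 'I_2 -> nat) : 'M[R]_2 := diag_mx (\row_i p ^+ e i).

Let scale_mxE p e e' M : scale_mx p e e' M = dg p e *m M *m dg p e'.
Proof.
apply/matrixP => i j; rewrite mul_diag_mx mul_mx_diag !mxE.
by rewrite mulrAC.
Qed.

Let det_dg p e : \det (dg p e) = p ^+ (e 0 + e 1).
Proof.
rewrite det_diag !big_ord_recl big_ord0 !mxE mulr1 exprD.
by congr (_ * p ^+ e _); apply/val_inj.
Qed.

Lemma det_scale_mx p e e' M :
  \det (scale_mx p e e' M) = p ^+ (e 0 + e 1) * p ^+ (e' 0 + e' 1) * \det M.
Proof. by rewrite scale_mxE !det_mulmx !det_dg mulrAC. Qed.

Lemma det_scale_block p e e' (A B C : 'M[R]_2) :
  \det (block_mx (scale_mx p e e A) (scale_mx p e e' C)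
                 (scale_mx p e e' C)^T (scale_mx p e' e' B)) =
  (p ^+ (e 0 + e 1) * p ^+ (e' 0 + e' 1)) ^+ 2 * \det (block_mx A C C^T B).
Proof.
pose P := block_mx (dg p e) 0 0 (dg p e').
have dP : \det P = p ^+ (e 0 + e 1) * p ^+ (e' 0 + e' 1).
  by rewrite /P det_ublock !det_dg.
have -> : block_mx (scale_mx p e e A) (scale_mx p e e' C)
    (scale_mx p e e' C)^T (scale_mx p e' e' B) =
    P *m block_mx A C C^T B *m P.
  rewrite /P !mulmx_block !mul0mx !mulmx0 !addr0 !add0r !scale_mxE.
  by rewrite !trmx_mul /dg !tr_diag_mx mulmxA.
by rewrite !det_mulmx dP; ring.
Qed.

Variables (p : T -> R) (e e' : 'I_2 -> nat).
Variables (A B C : T -> 'M[R]_2) (NA NB NC : 'M[R]_2).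
Hypothesis p0 : p x @[x --> F] --> 0.
Hypothesis pn0 : \forall x \near F, p x != 0.
Hypothesis e_gt0 : (0 < e 0%R + e 1%R)%N.
Hypothesis e'_gt0 : (0 < e' 0%R + e' 1%R)%N.
Hypothesis cA : forall i j, scale_mx (p x) e e (A x) i j @[x --> F] --> NA i j.
Hypothesis cB : forall i j, scale_mx (p x) e' e' (B x) i j @[x --> F] --> NB i j.
Hypothesis cC : forall i j, scale_mx (p x) e e' (C x) i j @[x --> F] --> NC i j.
Hypothesis NA_gt0 : 0 < \det NA.
Hypothesis NC_lt : \det NC ^+ 2 < \det NA * \det NB.
Hypothesis N_gt0 : 0 < \det (block_mx NA NC NC^T NB).

(** With [X] and [Y] the scaling factors of the two modes, [(X Y)^2 * D = a Y^2 + b X^2 - 2 c X Y].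
    In the limit [c ^ 2 < a * b], so this form is positive definite in [(Y, X)] and exceeds
    [2 (X Y)^2] once [X] and [Y] are small. The same expression tends to 0, whereas [(X Y)^2] times
    the full determinant has a positive limit. Both factors tend to 0 because each mode has at least
    one growing generator. *)
Lemma det_asymptotics : \forall x \near F,
  let D := \det (A x) + \det (B x) - 2 * \det (C x) in
  2 <= D /\ D - 1 <= \det (block_mx (A x) (C x) (C x)^T (B x)).
Proof.
pose X x := p x ^+ (e 0 + e 1); pose Y x := p x ^+ (e' 0 + e' 1).
have X0 : X x @[x --> F] --> 0.
  rewrite /X -(prednK e_gt0) -[X in _ --> X](mul0r ((0 : R) ^+ (e 0%R + e 1%R).-1)).
  by under eq_fun do rewrite exprS; apply: cvgM => //; exact: cvgX.
have Y0 : Y x @[x --> F] --> 0.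
  rewrite /Y -(prednK e'_gt0) -[X in _ --> X](mul0r ((0 : R) ^+ (e' 0%R + e' 1%R).-1)).
  by under eq_fun do rewrite exprS; apply: cvgM => //; exact: cvgX.
pose a x := \det (scale_mx (p x) e e (A x)).
pose b x := \det (scale_mx (p x) e' e' (B x)).
pose c x := \det (scale_mx (p x) e e' (C x)).
pose d x := \det (block_mx (scale_mx (p x) e e (A x)) (scale_mx (p x) e e' (C x))
  (scale_mx (p x) e e' (C x))^T (scale_mx (p x) e' e' (B x))).
have ca : a x @[x --> F] --> \det NA by exact: cvg_det.
have cb : b x @[x --> F] --> \det NB by exact: cvg_det.
have cc : c x @[x --> F] --> \det NC by exact: cvg_det.
have cd : d x @[x --> F] --> \det (block_mx NA NC NC^T NB).
  apply: cvg_det => i j; rewrite -(splitK i) -(splitK j).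
  case: (fintype.split i) => i'; case: (fintype.split j) => j' /=.
  - by under eq_fun do rewrite block_mxEul; rewrite block_mxEul; exact: cA.
  - by under eq_fun do rewrite block_mxEur; rewrite block_mxEur; exact: cC.
  - by under eq_fun do rewrite block_mxEdl mxE; rewrite block_mxEdl mxE; exact: cC.
  - by under eq_fun do rewrite block_mxEdr; rewrite block_mxEdr; exact: cB.
have X20 : X x ^+ 2 @[x --> F] --> 0.
  by rewrite -[X in _ --> X](expr0n _ 2); exact: cvgX.
have Y20 : Y x ^+ 2 @[x --> F] --> 0.
  by rewrite -[X in _ --> X](expr0n _ 2); exact: cvgX.
(* Lowering [a] by [X^2] and [b] by [Y^2] subtracts exactly [2 (X Y)^2] from the quadratic form,
   which accounts for the constant in [2 <= D]. *)
have ca1 : a x - X x ^+ 2 @[x --> F] --> \det NA.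
  by rewrite -[X in _ --> X]subr0; exact: cvgB.
have cb1 : b x - Y x ^+ 2 @[x --> F] --> \det NB.
  by rewrite -[X in _ --> X]subr0; exact: cvgB.
have cq : (a x - X x ^+ 2) * (b x - Y x ^+ 2) - c x ^+ 2 @[x --> F] -->
    \det NA * \det NB - \det NC ^+ 2.
  by apply: cvgB; [exact: cvgM|exact: cvgX].
have cr : d x - (a x * Y x ^+ 2 + b x * X x ^+ 2 - 2 * (c x * (X x * Y x)))
    @[x --> F] --> \det (block_mx NA NC NC^T NB).
  have -> : \det (block_mx NA NC NC^T NB) = \det (block_mx NA NC NC^T NB) -
     (\det NA * 0 + \det NB * 0 - 2 * (\det NC * (0 * 0))) by ring.
  apply: cvgB => //; apply: cvgB; first by apply: cvgD; exact: cvgM.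
  by apply: cvgM; [exact: cvg_cst|apply: cvgM => //; exact: cvgM].
near=> x.
have px : p x != 0 by near: x.
have Xn : X x != 0 by exact: expf_neq0.
have Yn : Y x != 0 by exact: expf_neq0.
have aE : a x = X x ^+ 2 * \det (A x) by rewrite /a det_scale_mx -expr2.
have bE : b x = Y x ^+ 2 * \det (B x) by rewrite /b det_scale_mx -expr2.
have cE : c x = X x * Y x * \det (C x) by rewrite /c det_scale_mx.
have dE : d x = (X x * Y x) ^+ 2 * \det (block_mx (A x) (C x) (C x)^T (B x)).
  by rewrite /d det_scale_block.
have h1 : 0 < a x - X x ^+ 2 by near: x; exact: cvgr_gt ca1 _ NA_gt0.
have h2 : 0 < (a x - X x ^+ 2) * (b x - Y x ^+ 2) - c x ^+ 2.
  by near: x; apply: cvgr_gt cq _ _; rewrite subr_gt0.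
have h3 : 0 < d x - (a x * Y x ^+ 2 + b x * X x ^+ 2 - 2 * (c x * (X x * Y x))).
  by near: x; exact: cvgr_gt cr _ N_gt0.
have P0 : 0 < (X x * Y x) ^+ 2 by rewrite lt_def sqr_ge0 sqrf_eq0 mulf_neq0.
set D := _ - _; have DE : (X x * Y x) ^+ 2 * D =
    a x * Y x ^+ 2 + b x * X x ^+ 2 - 2 * (c x * (X x * Y x)).
  by rewrite aE bE cE /D; ring.
split.
  rewrite -subr_ge0 -(pmulr_rge0 _ P0) mulrBr DE.
  (* Multiplying by the positive coefficient [a - X^2] completes the square. *)
  rewrite -(pmulr_rge0 _ h1).
  have -> : (a x - X x ^+ 2) * (a x * Y x ^+ 2 + b x * X x ^+ 2 -
      2 * (c x * (X x * Y x)) - (X x * Y x) ^+ 2 * 2) =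
    ((a x - X x ^+ 2) * Y x - c x * X x) ^+ 2 +
    ((a x - X x ^+ 2) * (b x - Y x ^+ 2) - c x ^+ 2) * X x ^+ 2 by ring.
  by rewrite addr_ge0 ?sqr_ge0 // mulr_ge0 ?sqr_ge0 // ltW.
(* The stronger bound of [D] by the full determinant is what [h3] provides. *)
rewrite lerBlDr; apply: ler_wpDr => //; rewrite -(ler_pM2l P0) DE -dE.
by move: h3; rewrite subr_gt0 => /ltW.
Unshelve. all: end_near. Qed.

End Asymptotics.

(** The quantity under the root is the smaller zero of [t^2 - D t + det]. This polynomial is
    non-negative at 1 and has its vertex [D / 2] at or beyond 1, so the zero is at least 1. A
    negative discriminant is covered too: [Num.sqrt] is then 0 and the value is [D / 2]. *)
Lemma log_negativity_eq0 (R : realType) (sigma : observable R -> observable R -> R) A B :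
    let sA := cov_mx sigma A A in let sB := cov_mx sigma B B in
    let C := cov_mx sigma A B in
    let D := \det sA + \det sB - 2 * \det C in
    2 <= D -> D - 1 <= \det (block_mx sA C C^T sB) ->
  log_negativity sigma A B = 0.
Proof.
move=> sA sB C D D2 dD; rewrite /log_negativity -/sA -/sB -/C -/D.
set d := \det _ in dD *; apply/max_idPl; rewrite oppr_le0 /log2.
apply: divr_ge0; apply: ln_ge0; last by rewrite ler1n.
rewrite -[leLHS]sqrtr1 ler_wsqrtr // ler_pdivlMr // mul1r lerBrDl -lerBrDr.
have D0 : 0 <= D - 2 by rewrite subr_ge0.
rewrite -(ger0_norm D0) -sqrtr_sqr ler_wsqrtr //.
by rewrite -subr_ge0; apply: le_trans (_ : 4 * (d - (D - 1)) <= _);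
   [rewrite mulr_ge0 // subr_ge0 | rewrite le_eqVlt; apply/orP; left; apply/eqP; ring].
Qed.

(** * Square-integrable functions *)

Section SquareIntegrable.
Context d (T : measurableType d) (R : realType).
Variable mu : {measure set T -> \bar R}.
Implicit Types (u v : T -> R) (U V W : bool -> T -> R).

Lemma ae_imply (P Q : T -> Prop) : (forall x, P x -> Q x) ->
  {ae mu, forall x, P x} -> {ae mu, forall x, Q x}.
Proof. by move=> PQ; apply: filterS. Qed.

Lemma ae_imply2 (P Q S : T -> Prop) : (forall x, P x -> Q x -> S x) ->
  {ae mu, forall x, P x} -> {ae mu, forall x, Q x} -> {ae mu, forall x, S x}.
Proof. by move=> PQ; apply: filterS2. Qed.

Lemma integrable_le (f g : T -> R) : measurable_fun setT f ->
  (forall x, `|f x| <= g x) -> mu.-integrable setT (EFin \o g) ->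
  mu.-integrable setT (EFin \o f).
Proof.
move=> mf fg; apply: le_integrable => //; first exact/measurable_EFinP.
by move=> x _ /=; rewrite lee_fin (le_trans (fg x)) // ler_norm.
Qed.

Lemma integrable_measurable (f : T -> R) :
  mu.-integrable setT (EFin \o f) -> measurable_fun setT f.
Proof. by move=> /measurable_int/measurable_EFinP. Qed.

Lemma integrable_bmul (f g : T -> R) M : mu.-integrable setT (EFin \o f) ->
  measurable_fun setT g -> (forall x, `|g x| <= M) ->
  mu.-integrable setT (EFin \o (fun x => f x * g x)).
Proof.
move=> fi mg gM; apply: (@integrable_le _ (fun x => M * `|f x|)).
- by apply: measurable_funM => //; exact: integrable_measurable.
- by move=> x; rewrite normrM mulrC ler_wpM2r.
- have := integrableZl measurableT M (integrable_norm fi).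
  by apply: eq_integrable.
Qed.

Lemma integrable_lincomb (J : Type) (s : seq J) (c : J -> R) (f : J -> T -> R) :
  (forall i, mu.-integrable setT (EFin \o f i)) ->
  mu.-integrable setT (EFin \o (fun x => \sum_(i <- s) c i * f i x)).
Proof.
move=> fi; have -> : EFin \o (fun x => \sum_(i <- s) c i * f i x) =
    (fun x => \sum_(i <- s) (c i)%:E * (f i x)%:E)%E.
  by apply/funext => x /=; rewrite -sumEFin.
by apply: integrable_sum => // i _; apply: (integrableZl measurableT (c i) (fi i)).
Qed.

Lemma Rintegral_lincomb (J : Type) (s : seq J) (c : J -> R) (f : J -> T -> R) :
  (forall i, mu.-integrable setT (EFin \o f i)) ->
  Rintegral mu setT (fun x => \sum_(i <- s) c i * f i x) =
  \sum_(i <- s) c i * Rintegral mu setT (f i).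
Proof.
move=> fi; elim: s => [|i s IHs].
  under eq_Rintegral do rewrite big_nil.
  by rewrite big_nil Rintegral_cst // mul0r.
have ci : mu.-integrable setT (EFin \o (fun x => c i * f i x)).
  by apply: eq_integrable (integrableZl measurableT (c i) (fi i)).
under eq_Rintegral do rewrite big_cons.
rewrite big_cons -IHs -RintegralZl // -RintegralD //.
exact: integrable_lincomb.
Qed.

Lemma ae_eq0_Rintegral (f : T -> R) : measurable_fun setT f ->
  {ae mu, forall x, f x = 0} -> Rintegral mu setT f = 0.
Proof.
move=> mf f0; rewrite /Rintegral (@ae_eq_integral _ _ _ mu _ (cst 0%E)) //.
- by rewrite integral0.
- exact/measurable_EFinP.
- by apply: filterS f0 => x /= -> _.
Qed.

Lemma Rintegral_eq0_ae (f : T -> R) : mu.-integrable setT (EFin \o f) ->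
  (forall x, 0 <= f x) -> Rintegral mu setT f = 0 -> {ae mu, forall x, f x = 0}.
Proof.
move=> fi f0 If0.
have mf : measurable_fun setT (EFin \o f) by exact: measurable_int fi.
suff : ae_eq mu setT (EFin \o f) (cst 0%E).
  by apply: filterS => x /= /(_ I) [].
apply/(ae_eq_integral_abs mu measurableT mf).
rewrite (@eq_integral _ _ _ mu _ (EFin \o f)); last first.
  by move=> x _ /=; rewrite ger0_norm.
rewrite -[LHS]fineK ?integrable_fin_num //.
by congr EFin.
Qed.

Definition square_integrable u :=
  measurable_fun setT u /\ mu.-integrable setT (EFin \o (fun x => u x ^+ 2)).

Lemma square_integrableM u v : square_integrable u -> square_integrable v ->
  mu.-integrable setT (EFin \o (fun x => u x * v x)).
Proof.
move=> [mu' u2] [mv v2].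
apply: (@integrable_le _ (fun x => u x ^+ 2 + v x ^+ 2)).
- exact: measurable_funM.
- move=> x; rewrite ler_norml; apply/andP; split.
    by rewrite -subr_ge0; apply: le_trans (_ : ((u x + v x)^+2 + (u x ^+ 2 + v x ^+ 2)) / 2 <= _);
      [rewrite divr_ge0 // !addr_ge0 // sqr_ge0 | lra].
  by rewrite -subr_ge0; apply: le_trans (_ : ((u x - v x)^+2 + (u x ^+ 2 + v x ^+ 2)) / 2 <= _);
      [rewrite divr_ge0 // !addr_ge0 // sqr_ge0 | lra].
- exact: (integrableD measurableT u2 v2).
Qed.

Lemma square_integrableD u v : square_integrable u -> square_integrable v ->
  square_integrable (fun x => u x + v x).
Proof.
move=> su sv; have uv := square_integrableM su sv.
case: su sv => [mu' u2] [mv v2]; split; first exact: measurable_funD.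
apply: eq_integrable
  (integrableD measurableT (integrableD measurableT u2 v2) (integrableD measurableT uv uv)) => //.
by move=> x _ /=; rewrite -!EFinD; congr EFin; ring.
Qed.

Lemma square_integrableZ a u : square_integrable u ->
  square_integrable (fun x => a * u x).
Proof.
move=> [mu' u2]; split; first exact: measurable_funM.
apply: eq_integrable (integrableZl measurableT (a ^+ 2) u2) => // x _ /=.
by rewrite -EFinM exprMn.
Qed.

Lemma square_integrable_sum (J : Type) (s : seq J) (c : J -> R) (w : J -> T -> R) :
  (forall i, square_integrable (w i)) ->
  square_integrable (fun x => \sum_(i <- s) c i * w i x).
Proof.
move=> sw; elim: s => [|i s IH].
  under eq_fun do rewrite big_nil.
  split; first exact: measurable_cst.
  by rewrite expr0n /=; exact: integrable0.
under eq_fun do rewrite big_cons.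
by apply: square_integrableD => //; exact: square_integrableZ.
Qed.

Definition sqint U := forall b, square_integrable (U b).

(* The inner product of two complex functions, given by their real and
   imaginary parts, as a real bilinear form. *)
Definition inner U V : R :=
  Rintegral mu setT (fun x => U true x * V true x + U false x * V false x).

Definition lincomb (J : finType) (c : J -> R) (W : J -> bool -> T -> R) :
  bool -> T -> R := fun b x => \sum_i c i * W i b x.

Lemma sqint_lincomb (J : finType) (c : J -> R) (W : J -> bool -> T -> R) :
  (forall i, sqint (W i)) -> sqint (lincomb c W).
Proof. by move=> sW b; apply: square_integrable_sum => i; exact: sW. Qed.

Lemma sqint_inner U V : sqint U -> sqint V -> mu.-integrable setT
  (EFin \o (fun x => U true x * V true x + U false x * V false x)).
Proof.
move=> sU sV.
exact: (integrableD measurableT (square_integrableM (sU true) (sV true))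
  (square_integrableM (sU false) (sV false))).
Qed.

Lemma innerC U V : inner U V = inner V U.
Proof. by apply: eq_Rintegral => x _; rewrite mulrC [X in _ + X]mulrC. Qed.

Lemma inner_lincombl (J : finType) (c : J -> R) (W : J -> bool -> T -> R) V :
  (forall i, sqint (W i)) -> sqint V ->
  inner (lincomb c W) V = \sum_i c i * inner (W i) V.
Proof.
move=> sW sV; rewrite /inner.
have wi i := sqint_inner (sW i) sV.
rewrite -Rintegral_lincomb //.
apply: eq_Rintegral => x _; rewrite /lincomb !mulr_suml -big_split /=.
by apply: eq_bigr => i _; ring.
Qed.

Lemma inner_lincombr (J : finType) (c : J -> R) (W : J -> bool -> T -> R) V :
  (forall i, sqint (W i)) -> sqint V ->
  inner V (lincomb c W) = \sum_i c i * inner V (W i).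
Proof.
move=> sW sV; rewrite innerC inner_lincombl //.
by apply: eq_bigr => i _; rewrite innerC.
Qed.

Lemma inner_ge0 U : 0 <= inner U U.
Proof. by apply: Rintegral_ge0 => x _; rewrite addr_ge0 // -expr2 sqr_ge0. Qed.

Lemma inner_eq0 U : sqint U -> inner U U = 0 -> {ae mu, forall x, forall b, U b x = 0}.
Proof.
move=> sU U0; have := Rintegral_eq0_ae (sqint_inner sU sU) _ U0.
move=> /(_ _)/wrap[]; first by move=> x; rewrite addr_ge0 // -expr2 sqr_ge0.
apply: filterS => x /eqP; rewrite -!expr2 paddr_eq0 ?sqr_ge0 // !sqrf_eq0.
by move=> /andP[/eqP ut /eqP uf] [].
Qed.

End SquareIntegrable.

(** * Taylor expansion of the cosine *)

Section Taylor.
Variable R : realType.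

Lemma is_derive_ge0_le (f df : R -> R) (x : R) : 0 <= x ->
  (forall y : R, is_derive y (1 : R) f (df y)) -> (forall y, 0 <= y -> 0 <= df y) ->
  f 0 <= f x.
Proof.
move=> x0 fd df0; have [c] : exists2 c, c \in `[0, x]%R & f x - f 0 = df c * (x - 0).
  apply: MVT_segment => //; apply: derivable_within_continuous => y _.
  exact: (@ex_derive _ _ _ _ _ _ _ (fd y)).
rewrite in_itv /= => /andP[c0 _] fE.
by rewrite -subr_ge0 fE subr0 mulr_ge0 // df0.
Qed.

(** The [n]-th derivative of cosine is a shift by [n * (pi / 2)]. Carrying the phase [th] makes the
    family closed under differentiation and covers the sine as well. *)
Definition cos_taylor (N : nat) (th : R) : {poly R} :=
  \poly_(n < N) (cos (th + n%:R * (pi / 2)) / n`!%:R).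

Lemma deriv_cos_taylor N th :
  (cos_taylor N.+1 th)^`() = cos_taylor N (th + pi / 2).
Proof.
apply/polyP => i; rewrite coef_deriv !coef_poly ltnS.
case: ifP => // _; last by rewrite mul0rn.
have -> : th + i.+1%:R * (pi / 2) = th + pi / 2 + i%:R * (pi / 2).
  by rewrite -natr1; ring.
rewrite -[LHS]mulr_natr factS natrM -mulrA; congr (_ * _).
by rewrite invfM mulrAC mulVf ?mul1r // pnatr_eq0.
Qed.

Let rem N th x := cos (x + th) - (cos_taylor N th).[x].

Lemma is_derive_cos_rem N th (x : R) :
  is_derive x (1 : R) (rem N.+1 th) (rem N (th + pi / 2) x).
Proof.
have h : is_derive x (1 : R) (fun x => cos (x + th)) (- sin (x + th)).
  have -> : (fun x => cos (x + th)) = cos \o shift th by [].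
  by apply: is_derive_eq; rewrite addr0 mulr1.
rewrite /rem -deriv_cos_taylor addrA cosDpihalf.
exact: is_deriveB.
Qed.

Lemma cos_taylor0 N th : (cos_taylor N.+1 th).[0] = cos th.
Proof. by rewrite horner_coef0 coef_poly /= mul0r addr0 fact0 divr1. Qed.

Lemma cos_taylorN N th x : (cos_taylor N th).[- x] = (cos_taylor N (- th)).[x].
Proof.
have key i t : cos (- t + i%:R * (pi / 2)) = cos (t + i%:R * (pi / 2)) * (-1) ^+ i :> R.
  elim: i t => [|i IHi] t; first by rewrite expr0 mulr1 !mul0r !addr0 cosN.
  have -> : t + i.+1%:R * (pi / 2) = (t + pi / 2) + i%:R * (pi / 2).
    by rewrite -natr1; ring.
  rewrite [(-1) ^+ _.+1]exprSr [RHS]mulrA -IHi.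
  have -> : - (t + pi / 2) + i%:R * (pi / 2) = (- t + i.+1%:R * (pi / 2)) - pi.
    by rewrite -natr1; field.
  by rewrite cosB cospi sinpi; ring.
rewrite !horner_poly; apply: eq_bigr => i _.
by rewrite key [(- x) ^+ _]exprNn; ring.
Qed.

(** Induction on [N] for all phases at once: the derivative of a remainder is the remainder of one
    order less at phase [th + pi / 2], and that of [x^(N+1) / (N+1)!] is its bound. Parity reduces
    negative [x] to positive [x]. *)
Lemma cos_taylor_bound N th x :
  `|cos (x + th) - (cos_taylor N th).[x]| <= `|x| ^+ N / N`!%:R.
Proof.
wlog x0 : x th / 0 <= x => [hw|].
  have [/hw//|/ltW x0] := leP 0 x.
  have := hw (- x) (- th); rewrite oppr_ge0 x0 => /(_ isT).
  by rewrite -opprD cosN cos_taylorN opprK normrN.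
rewrite (ger0_norm x0); elim: N th x x0 => [|N IHN] th x x0.
  by rewrite expr0 fact0 divr1 /cos_taylor poly_def big_ord0 horner0 subr0 cos_max.
pose p : {poly R} := (N.+1`!%:R)^-1 *: 'X^(N.+1).
have pE y : p.[y] = y ^+ N.+1 / N.+1`!%:R by rewrite hornerZ hornerXn mulrC.
have dpE y : p^`().[y] = y ^+ N / N`!%:R.
  rewrite derivZ derivXn hornerZ hornerMn hornerXn /= factS natrM invfM.
  rewrite -[y ^+ N *+ _]mulr_natl mulrA [_ / _ * _]mulrAC mulVf ?pnatr_eq0 //.
  by rewrite mul1r mulrC.
have p0 : p.[0] = 0 by rewrite pE expr0n mul0r.
have r0 : rem N.+1 th 0 = 0 by rewrite /rem cos_taylor0 add0r subrr.
have bd y : 0 <= y -> - p^`().[y] <= rem N (th + pi / 2) y <= p^`().[y].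
  by move=> y0; rewrite -ler_norml dpE; exact: IHN.
rewrite ler_norml -pE -/(rem N.+1 th x); apply/andP; split.
  have := @is_derive_ge0_le (rem N.+1 th + horner p) (fun y => rem N (th + pi / 2) y + p^`().[y]) x x0.
  rewrite !fctE r0 p0 addr0 => h; rewrite -subr_ge0 opprK; apply: h.
    by move=> y; have ? := is_derive_cos_rem N th y; exact: is_deriveD.
  by move=> y /bd /andP[+ _]; rewrite -subr_ge0 opprK.
have := @is_derive_ge0_le (horner p - rem N.+1 th) (fun y => p^`().[y] - rem N (th + pi / 2) y) x x0.
rewrite !fctE r0 p0 subrr => h; rewrite -subr_ge0; apply: h.
  by move=> y; have ? := is_derive_cos_rem N th y; exact: is_deriveB.
by move=> y /bd /andP[_ +]; rewrite -subr_ge0.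
Qed.

Lemma cos_lipschitz (a b : R) : `|cos a - cos b| <= `|a - b|.
Proof.
have := cos_taylor_bound 1 b (a - b); rewrite subrK expr1 factS fact0 mul1n divr1.
by rewrite (_ : (cos_taylor 1 b).[a - b] = cos b) // horner_poly big_ord1 mul0r addr0 fact0 divr1 expr0 mulr1.
Qed.

End Taylor.

(** * Fourier transforms *)

Section Volume.
Variable R : realType.
Local Notation mu := (@vol R).
Local Notation R3 := (Defs.space R).
Local Notation mR3 := (Defs.space (measurableTypeR R)).
Local Notation leb := (@lebesgue_measure R).

Lemma measurable_coordinates :
  [/\ measurable_fun [set: mR3] (fun x : mR3 => x.1.1 : R),
      measurable_fun [set: mR3] (fun x : mR3 => x.1.2 : R)
    & measurable_fun [set: mR3] (fun x : mR3 => x.2 : R)].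
Proof.
split.
- by apply: (measurableT_comp measurable_fst); exact: measurable_fst.
- by apply: (measurableT_comp measurable_snd); exact: measurable_fst.
- exact: measurable_snd.
Qed.

Lemma volX (A B C : set (measurableTypeR R)) :
  measurable A -> measurable B -> measurable C ->
  mu ((A `*` B) `*` C) = (leb A * leb B * leb C)%E.
Proof.
move=> mA mB mC; rewrite /vol /=.
rewrite product_measure1E //; last exact: measurableX.
by congr (_ * _)%E; exact: product_measure1E.
Qed.

Definition cube (r : R) : set mR3 :=
  (`[- r, r]%classic `*` `[- r, r]%classic) `*` `[- r, r]%classic.

Lemma measurable_cube r : measurable (cube r).
Proof. by do 2 (apply: measurableX => //). Qed.

Lemma cubeE r (x : mR3) :
  cube r x <-> [/\ `|x.1.1| <= r, `|x.1.2| <= r & `|x.2| <= r].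
Proof.
rewrite /cube /= !in_itv /= -!ler_norml.
by split=> [[[]]|[]].
Qed.

Lemma vol_cube r : 0 <= r -> mu (cube r) = ((2 * r) ^+ 3)%:E.
Proof.
move=> r0; rewrite /cube volX // lebesgue_measure_itv /= lte_fin.
have [rr|rr] := ltP (- r) r.
  by rewrite -!EFinB -!EFinM; congr EFin; ring.
have -> : r = 0 by lra.
by rewrite mulr0 expr0n /= !mul0e.
Qed.

Lemma vol_sigma_finite : sigma_finite setT mu.
Proof.
exists (fun n => cube n%:R).
  apply/seteqP; split => // x _.
  have h := ltW (truncnS_gt (`|x.1.1| + `|x.1.2| + `|x.2|)).
  have := normr_ge0 x.1.1; have := normr_ge0 x.1.2; have := normr_ge0 x.2.
  move=> x1 x2 x3; exists (Num.truncn (`|x.1.1| + `|x.1.2| + `|x.2|)).+1 => //.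
  by apply/cubeE; split; lra.
by move=> n; split; [exact: measurable_cube | rewrite vol_cube // ltry].
Qed.

(* [vol] as a sigma-finite measure, which the Tonelli lemmas ask for. *)
Definition sigma_finite_vol : {sigma_finite_measure set mR3 -> \bar R} :=
  HB.pack_for {sigma_finite_measure set mR3 -> \bar R}
    (mu : set mR3 -> \bar R) (Measure.class mu)
    (@Measure_isSigmaFinite.Build _ _ _ mu vol_sigma_finite).

Lemma measurable_tonelli (f : mR3 * mR3 -> \bar R) :
  measurable_fun setT f -> (forall x, 0 <= f x)%E ->
  measurable_fun setT (fun k => \int[mu]_x f (k, x))%E.
Proof.
by move=> mf f0; exact: (@measurable_fun_fubini_tonelli_F _ _ _ _ R sigma_finite_vol f).
Qed.

End Volume.

Section CosineTransform.
Variable R : realType.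
Local Notation mu := (@vol R).
Local Notation R3 := (Defs.space R).
Local Notation mR3 := (Defs.space (measurableTypeR R)).
Implicit Types (h : R3 -> R) (k : R3) (th : R).

Definition integrable3 h := mu.-integrable setT (EFin \o h).

(** Phase 0 gives the real part of the Fourier transform and phase [- (pi / 2)] the imaginary part.
    A free phase keeps this real family closed under Taylor expansion and under products with
    cosines. *)
Definition cosft h k th : R := Rintegral mu setT (fun x => h x * cos (dot x k + th)).

Lemma measurable_dot_prod :
  measurable_fun [set: mR3 * mR3] (fun p => dot p.2 p.1 : R).
Proof.
have [m1 m2 m3] := measurable_coordinates R.
apply: measurable_funD; first apply: measurable_funD; apply: measurable_funM.
- exact: (measurableT_comp m1 measurable_snd).
- exact: (measurableT_comp m1 measurable_fst).
- exact: (measurableT_comp m2 measurable_snd).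
- exact: (measurableT_comp m2 measurable_fst).
- exact: (measurableT_comp m3 measurable_snd).
- exact: (measurableT_comp m3 measurable_fst).
Qed.

Lemma measurable_dot (k : R3) : measurable_fun [set: mR3] (fun x => dot x k : R).
Proof. exact: (measurableT_comp measurable_dot_prod (measurable_pair1 k)). Qed.

Lemma measurable_cos : measurable_fun [set: R] (@cos R).
Proof. apply: continuous_measurable_fun; exact: continuous_cos. Qed.

Lemma measurable_cos_dot_prod th :
  measurable_fun [set: mR3 * mR3] (fun p => cos (dot p.2 p.1 + th) : R).
Proof.
apply: (measurableT_comp measurable_cos).
by apply: measurable_funD; [exact: measurable_dot_prod|exact: measurable_cst].
Qed.

Lemma measurable_cos_dot k th :
  measurable_fun [set: mR3] (fun x => cos (dot x k + th) : R).
Proof.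
have := measurableT_comp (measurable_cos_dot_prod th) (measurable_pair1 k).
exact.
Qed.

Lemma integrable_cosft h k th : integrable3 h ->
  mu.-integrable setT (EFin \o (fun x => h x * cos (dot x k + th))).
Proof.
move=> hi; apply: (@integrable_bmul _ _ _ _ _ _ 1 hi).
  exact: measurable_cos_dot.
by move=> x; rewrite cos_max.
Qed.

Lemma dotC (x k : R3) : dot x k = dot k x.
Proof. by rewrite /dot; ring. Qed.

Lemma Re_fourier h k : complex.Re (fourier h k) = cosft h k 0.
Proof.
rewrite /fourier /Cintegral /cosft /=; apply: eq_Rintegral => x _.
by rewrite addr0 /= mul0r subr0 // dotC.
Qed.

Lemma Im_fourier h k : complex.Im (fourier h k) = cosft h k (- (pi / 2)).
Proof.
rewrite /fourier /Cintegral /cosft /=; apply: eq_Rintegral => x _.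
by rewrite cosBpihalf /= mul0r addr0 // dotC.
Qed.

(** Tonelli's theorem needs a non-negative integrand, so [h] is split into positive and negative
    parts and the cosine is replaced by [1 + cos]; the surplus is the constant integral of [h]. *)
Lemma measurable_cosft h th : integrable3 h ->
  measurable_fun [set: mR3] (fun k => cosft h k th).
Proof.
move=> hi; have mh := integrable_measurable hi.
pose P s (x : R3) := Num.max (s * h x) 0.
have P0 s x : 0 <= P s x by rewrite le_max lexx orbT.
have Pi (s : R) : `|s| = 1 -> integrable3 (P s).
  move=> s1; rewrite /integrable3; apply: (@integrable_le _ _ _ mu (P s) (fun x => `|h x|)).
  - by apply: measurable_maxr => //; exact: measurable_funM.
  - move=> x; rewrite (ger0_norm (P0 _ _)) ge_max normr_ge0 andbT.
    by rewrite (le_trans (ler_norm _)) // normrM s1 mul1r.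
  - exact: integrable_norm.
pose J s k := Rintegral mu setT (fun x => P s x * (1 + cos (dot x k + th))).
have Ji (s : R) k : `|s| = 1 -> mu.-integrable setT (EFin \o (fun x => P s x * (1 + cos (dot x k + th)))).
  move=> /Pi hs; apply: (@integrable_bmul _ _ _ _ _ _ 2 hs).
    by apply: measurable_funD => //; exact: measurable_cos_dot.
  move=> x; rewrite (le_trans (ler_normD _ _)) // normr1 (_ : 2 = 1 + 1) //.
  by rewrite lerD2l cos_max.
have mJ (s : R) : `|s| = 1 -> measurable_fun [set: mR3] (J s).
  move=> s1; apply: (measurableT_comp (fine_measurable measurableT)).
  apply: (@measurable_tonelli _ (fun p => (P s p.2 * (1 + cos (dot p.2 p.1 + th)))%:E)).
    apply/measurable_EFinP; apply: measurable_funM.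
      exact: (measurableT_comp (integrable_measurable (Pi s s1)) measurable_snd).
    by apply: measurable_funD => //; exact: measurable_cos_dot_prod.
  move=> x; rewrite lee_fin mulr_ge0 //.
have -> : (fun k => cosft h k th) = (fun k => J 1 k - J (-1) k - Rintegral mu setT h).
  apply/funext => k.
  have i1 := Ji 1 k (normr1 R); have i2 := Ji (-1) k (normrN1 R).
  have i12 := integrableB measurableT i1 i2.
  rewrite /J -(RintegralB measurableT i1 i2) -(RintegralB measurableT i12 hi).
  apply: eq_Rintegral => x _; rewrite -mulrBl.
  have -> : P 1 x - P (-1) x = h x.
    rewrite /P mul1r mulN1r /Num.max.
    by case: ltP => h1; case: ltP => h2; lra.
  by ring.
apply: measurable_funB => //; apply: measurable_funB; apply: mJ.
  by rewrite normr1.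
by rewrite normrN1.
Qed.

Lemma cosft_lin (J : finType) (c : J -> R) (hs : J -> R3 -> R) k th :
  (forall i, integrable3 (hs i)) ->
  cosft (fun x => \sum_i c i * hs i x) k th = \sum_i c i * cosft (hs i) k th.
Proof.
move=> hi; rewrite /cosft -Rintegral_lincomb; last by move=> i; exact: integrable_cosft.
apply: eq_Rintegral => x _; rewrite mulr_suml.
by apply: eq_bigr => i _; rewrite mulrA.
Qed.

Lemma integrable3_lin (J : finType) (c : J -> R) (hs : J -> R3 -> R) :
  (forall i, integrable3 (hs i)) -> integrable3 (fun x => \sum_i c i * hs i x).
Proof.
by move=> hi; exact: integrable_lincomb.
Qed.

Lemma cosft_ae0 h k th : integrable3 h -> {ae mu, forall x, h x = 0} ->
  cosft h k th = 0.
Proof.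
move=> hi h0; apply: ae_eq0_Rintegral.
  exact: integrable_measurable (integrable_cosft k th hi).
by apply: ae_imply h0 => x ->; rewrite mul0r.
Qed.

Lemma cosft_bound h k th : integrable3 h ->
  `|cosft h k th| <= Rintegral mu setT (fun x => `|h x|).
Proof.
move=> hi; apply: le_trans (le_normr_Rintegral measurableT (integrable_cosft k th hi)) _.
apply: le_Rintegral => //.
- exact: integrable_norm (integrable_cosft k th hi).
- exact: integrable_norm.
- by move=> x _; rewrite normrM ler_piMr // cos_max.
Qed.

Definition supported_in (L : R) h := forall x, h x != 0 -> cube L x.

Lemma dot_bound L (x : R3) k : cube L x ->
  `|dot x k| <= L * (`|k.1.1| + `|k.1.2| + `|k.2|).
Proof.
move=> /cubeE[h1 h2 h3]; rewrite /dot.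
rewrite (le_trans (ler_normD _ _)) // !mulrDr lerD //; last first.
  by rewrite normrM ler_wpM2r.
by rewrite (le_trans (ler_normD _ _)) // lerD // normrM ler_wpM2r.
Qed.

Lemma dotBr (x : R3) k k' : dot x k - dot x k' = dot x (k - k').
Proof. by rewrite /dot /=; ring. Qed.

Lemma cosft_lipschitz L h k k' th : integrable3 h -> supported_in L h ->
  `|cosft h k th - cosft h k' th| <=
  Rintegral mu setT (fun x => `|h x|) * (L * (`|(k - k').1.1| + `|(k - k').1.2| + `|(k - k').2|)).
Proof.
move=> hi hL; set M := L * _.
rewrite /cosft -RintegralB //; try exact: integrable_cosft.
have ii : mu.-integrable setT (EFin \o (fun x => h x * cos (dot x k + th) - h x * cos (dot x k' + th))).
  exact: (integrableB measurableT (integrable_cosft k th hi) (integrable_cosft k' th hi)).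
rewrite (le_trans (le_normr_Rintegral measurableT ii)) //.
rewrite -RintegralZr //; last exact: integrable_norm.
apply: le_Rintegral => //.
- exact: integrable_norm.
- by apply: (integrableZr measurableT M (integrable_norm hi)).
- move=> x _; rewrite -mulrBr normrM.
  have [->|h0] := eqVneq (h x) 0; first by rewrite normr0 !mul0r.
  rewrite ler_wpM2l // (le_trans (cos_lipschitz _ _)) //.
  by rewrite opprD addrACA subrr addr0 dotBr dot_bound //; exact: hL.
Qed.

(** Continuity turns relations between transforms that hold almost everywhere into pointwise
    ones. *)
Lemma continuous_cosft L h th : integrable3 h -> supported_in L h ->
  continuous (fun k : R3 => cosft h k th).
Proof.
move=> hi hL k0; apply/cvgrPdist_le => e e0.
set I := Rintegral mu setT (fun x => `|h x|).
have I0 : 0 <= I by exact: Rintegral_ge0.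
(* A Lipschitz constant for the sup norm, with 3 for the three coordinates; the added 1 keeps it
   positive when [I] or [L] is 0. *)
pose M := I * (`|L| * 3) + 1.
have M0 : 0 < M by rewrite ltr_wpDl // !mulr_ge0.
near=> k.
apply: le_trans (cosft_lipschitz _ _ _ hi hL) _; rewrite -/I.
have kd : `|k0 - k| <= e / M.
  by near: k; apply: cvgr_dist_le; rewrite ?divr_gt0.
have n1 : `|(k0 - k).1.1| <= e / M.
  by apply: le_trans kd; rewrite !prod_normE /= !le_max lexx.
have n2 : `|(k0 - k).1.2| <= e / M.
  by apply: le_trans kd; rewrite !prod_normE /= !le_max lexx orbT.
have n3 : `|(k0 - k).2| <= e / M.
  by apply: le_trans kd; rewrite !prod_normE /= !le_max lexx orbT.
apply: le_trans (_ : I * (`|L| * (3 * (e / M))) <= _).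
  rewrite ler_wpM2l //; apply: le_trans (ler_norm _) _; rewrite normrM ler_wpM2l //.
  by rewrite ger0_norm ?addr_ge0 //; lra.
have -> : I * (`|L| * (3 * (e / M))) = (I * (`|L| * 3)) * (e / M) by ring.
rewrite mulrCA ger_pMr // ler_pdivrMr // mul1r /M lerDl //.
Unshelve. all: end_near. Qed.

End CosineTransform.

(** * Entire functions along rays *)

Section PowerExpansion.
Variable R : realType.

(* [phi] is the sum of the power series [a], with the remainder estimate of an
   entire function of exponential type [M]. *)
Definition expands (phi : R -> R) (a : nat -> R) (K M : R) :=
  forall t N, `|phi t - \sum_(n < N) a n * t ^+ n| <= K * ((`|t| * M) ^+ N / N`!%:R).

Lemma expands_eq0 phi a K M : expands phi a K M -> (forall n, a n = 0) ->
  forall t, phi t = 0.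
Proof.
move=> ha a0 t; apply/eqP; rewrite -normr_le0.
have h N : `|phi t| <= K * exp_coeff (`|t| * M) N.
  have := ha t N; rewrite big1 ?subr0 // => n _; by rewrite a0 mul0r.
have c0 : K * exp_coeff (`|t| * M) N @[N --> \oo] --> K * 0.
  by apply: cvgM; [exact: cvg_cst|exact: cvg_series_cvg_0 (is_cvg_series_exp_coeff _)].
rewrite mulr0 in c0; rewrite -(cvg_lim _ c0) //.
apply: limr_ge; first by apply/cvg_ex; exists 0.
by apply: nearW.
Qed.

(** The remainder of order [n + 1], divided by [t ^+ n], is at most a constant times [t]. *)
Lemma expands_lead phi a K M n : expands phi a K M ->
  (forall i, (i < n)%N -> a i = 0) ->
  phi t / t ^+ n @[t --> 0^'+] --> a n.
Proof.
move=> ha a0; set C := K * (M ^+ n.+1 / n.+1`!%:R).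
have h t : 0 < t -> `|a n - phi t / t ^+ n| <= C * t.
  move=> t0; have := ha t n.+1.
  rewrite big_ord_recr /= big1 ?add0r; last by move=> i _; rewrite a0 ?mul0r.
  have tn : 0 < t ^+ n by exact: exprn_gt0.
  have -> : a n - phi t / t ^+ n = (a n * t ^+ n - phi t) / t ^+ n.
    by rewrite mulrBl mulfK // gt_eqF.
  rewrite normrM normfV (gtr0_norm tn) ler_pdivrMr // distrC => /le_trans -> //.
  by rewrite (gtr0_norm t0) exprMn exprS /C le_eqVlt; apply/orP; left; apply/eqP; ring.
apply/cvgrPdist_le => e e0.
have c0 : C * t @[t --> 0^'+] --> C * 0.
  by apply: cvgM; [exact: cvg_cst|apply: cvg_at_right_filter; exact: cvg_id].
rewrite mulr0 in c0.
near=> t.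
have t0 : 0 < t by near: t; exact: nbhs_right_gt.
apply: le_trans (h t t0) _; apply: ltW.
by near: t; exact: (cvgr_lt 0 c0).
Unshelve. all: end_near. Qed.

Lemma expands_coef0 phi a K M : expands phi a K M ->
  (forall t, 0 < t -> phi t = 0) -> forall n, a n = 0.
Proof.
move=> ha p0 n; elim/ltn_ind: n => n IH.
have := expands_lead ha IH.
have c0 : phi t / t ^+ n @[t --> 0^'+] --> 0.
  apply/cvgrPdist_le => e e0; near=> t.
  have t0 : 0 < t by near: t; exact: nbhs_right_gt.
  by rewrite p0 // mul0r subrr normr0 ltW.
by move=> /(cvg_unique _); apply => //.
Unshelve. all: end_near. Qed.

(* A nonzero [phi] vanishes to an integer order at 0, a nonzero [psi] too, and
   [al] shifts the order by a non-integer. *)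
Lemma expands_order phi psi a b K M K' M' (c al : R) :
  expands phi a K M -> expands psi b K' M' -> c != 0 ->
  (forall n m : nat, n%:R != m%:R + al) ->
  (forall t, 0 < t -> phi t + c * t `^ al * psi t = 0) ->
  (forall t, phi t = 0) /\ (forall t, psi t = 0).
Proof.
move=> ha hb c0 alN E.
have [a0|/existsNP an] := pselect (forall n, a n = 0).
  have p0 := expands_eq0 ha a0; split => //.
  apply: (expands_eq0 hb); apply: (expands_coef0 hb) => t t0.
  move/eqP: (E t t0); rewrite p0 add0r mulf_eq0 mulf_eq0 (negbTE c0) powR_eq0 (gt_eqF t0) /=.
  by move/eqP.
have [b0|/existsNP bn] := pselect (forall n, b n = 0).
  have q0 := expands_eq0 hb b0; case: an => n; case.
  by apply: (expands_coef0 ha) => t /E; rewrite q0 mulr0 addr0.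
exfalso.
have ex_lead (u : nat -> R) : (exists n, u n <> 0) ->
    exists2 n, u n != 0 & forall i, (i < n)%N -> u i = 0.
  move=> [i0 /eqP ui0]; have exu : exists i, u i != 0 by exists i0.
  exists (ex_minn exu); first by case: ex_minnP.
  case: ex_minnP => n _ minn i ilt; apply/eqP/negPn/negP => /minn.
  by rewrite leqNgt ilt.
have [n an0 /(expands_lead ha) cf] := ex_lead a an.
have [m bm0 /(expands_lead hb) cg] := ex_lead b bn.
have powD t : 0 < t -> t `^ (m%:R + al - n%:R) = t ^+ m * t `^ al / t ^+ n.
  move=> t0; rewrite powRB; last by apply/implyP => _; rewrite gt_eqF.
  rewrite powRD; last by apply/implyP => _; rewrite gt_eqF.
  by rewrite !powR_mulrn // ltW.
(* The two terms of the relation have orders [n] and [m + al] at 0. The one of lower order dominates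
   there, so the relation forces its leading coefficient to vanish. *)
have := alN n m; rewrite neq_lt => /orP[lt|gt].
  have : phi t / t ^+ n @[t --> 0^'+] --> 0.
    have c1 : - c * t `^ (m%:R + al - n%:R) * (psi t / t ^+ m) @[t --> 0^'+] --> - c * 0 * b m.
      apply: cvgM => //; apply: cvgM; first exact: cvg_cst.
      by apply: powR_cvg0; rewrite subr_gt0.
    rewrite mulr0 mul0r in c1.
    apply: cvg_trans c1; apply: near_eq_cvg; near=> t.
    have t0 : 0 < t by near: t; exact: nbhs_right_gt.
    have tn : t ^+ n != 0 by rewrite expf_neq0 // gt_eqF.
    have tm : t ^+ m != 0 by rewrite expf_neq0 // gt_eqF.
    have -> : phi t = - (c * t `^ al * psi t) by apply/eqP; rewrite -addr_eq0 E.
    by rewrite powD //; field; rewrite tn tm.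
  by move=> /(cvg_unique _ cf) h; rewrite h ?eqxx // in an0.
have : psi t / t ^+ m @[t --> 0^'+] --> 0.
  have c1 : - c^-1 * t `^ (n%:R - (m%:R + al)) * (phi t / t ^+ n) @[t --> 0^'+] --> - c^-1 * 0 * a n.
    apply: cvgM => //; apply: cvgM; first exact: cvg_cst.
    by apply: powR_cvg0; rewrite subr_gt0.
  rewrite mulr0 mul0r in c1.
  apply: cvg_trans c1; apply: near_eq_cvg; near=> t.
  have t0 : 0 < t by near: t; exact: nbhs_right_gt.
  have tn : t ^+ n != 0 by rewrite expf_neq0 // gt_eqF.
  have tm : t ^+ m != 0 by rewrite expf_neq0 // gt_eqF.
  have ta : t `^ al != 0 by rewrite powR_eq0 gt_eqF.
  have -> : phi t = - (c * t `^ al * psi t) by apply/eqP; rewrite -addr_eq0 E.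
  rewrite -opprB powRN powD //; field.
  by rewrite tn tm c0 ta.
by move=> /(cvg_unique _ cg) h; rewrite h ?eqxx // in bm0.
Unshelve. all: end_near. Qed.

End PowerExpansion.

Section Rays.
Variable R : realType.
Local Notation mu := (@vol R).
Local Notation R3 := (Defs.space R).
Implicit Types (h : R3 -> R) (k : R3) (th : R).

Definition ray (t : R) (e : R3) : R3 := ((t * e.1.1, t * e.1.2), t * e.2).

Lemma dot_ray (x e : R3) t : dot x (ray t e) = t * dot x e.
Proof. by rewrite /dot /=; ring. Qed.

Lemma euclid_norm_ray t (e : R3) : 0 <= t -> euclid_norm (ray t e) = t * euclid_norm e.
Proof.
move=> t0; rewrite /euclid_norm dot_ray.
have -> : dot (ray t e) e = t * dot e e by rewrite /dot /=; ring.
by rewrite mulrA -expr2 sqrtrM ?sqr_ge0 // sqrtr_sqr ger0_norm.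
Qed.

(** The Taylor series of the cosine is integrated term by term, so the coefficients are moments of
    [h] along [e]. Compact support bounds [dot x e] by [M], which is the exponential type. *)
Lemma cosft_expands h L e th : integrable3 h -> supported_in L h ->
  exists a K M, expands (fun t => cosft h (ray t e) th) a K M.
Proof.
move=> hi hL.
pose M := L * (`|e.1.1| + `|e.1.2| + `|e.2|).
pose K := Rintegral mu setT (fun x => `|h x|).
have md := measurable_dot e.
have hmi n : integrable3 (fun x => h x * dot x e ^+ n).
  apply: (@integrable_le _ _ _ mu _ (fun x => M ^+ n * `|h x|)).
  - apply: measurable_funM; first exact: (integrable_measurable hi).
    exact: measurable_funX.
  - move=> x; rewrite normrM mulrC; have [->|/hL hx] := eqVneq (h x) 0.
      by rewrite normr0 !mulr0.
    by rewrite ler_wpM2r // normrX lerXn2r ?nnegrE // ?(le_trans _ (dot_bound e hx)) // dot_bound.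
  - by have := integrableZl measurableT (M ^+ n) (integrable_norm hi); apply: eq_integrable.
(* The [n]-th coefficient is the same for every truncation beyond [n]; [n.+1] is the shortest. *)
exists (fun n => (cos_taylor n.+1 th)`_n * Rintegral mu setT (fun x => h x * dot x e ^+ n)), K, M.
move=> t N.
pose r x := h x * (cos (t * dot x e + th) - (cos_taylor N th).[t * dot x e]).
have tE x : h x * (cos_taylor N th).[t * dot x e] =
    \sum_(n < N) ((cos_taylor n.+1 th)`_n * t ^+ n) * (h x * dot x e ^+ n).
  rewrite horner_poly mulr_sumr; apply: eq_bigr => n _.
  by rewrite coef_poly ltnSn exprMn; ring.
have ti : mu.-integrable setT (EFin \o (fun x => h x * (cos_taylor N th).[t * dot x e])).
  under eq_fun do rewrite tE.
  exact: (integrable_lincomb _ _ (fun n : 'I_N => hmi n)).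
have -> : cosft h (ray t e) th - \sum_(n < N) (cos_taylor n.+1 th)`_n * Rintegral mu setT (fun x => h x * dot x e ^+ n) * t ^+ n
    = Rintegral mu setT r.
  have -> : \sum_(n < N) (cos_taylor n.+1 th)`_n * Rintegral mu setT (fun x => h x * dot x e ^+ n) * t ^+ n =
      Rintegral mu setT (fun x => h x * (cos_taylor N th).[t * dot x e]).
    under eq_Rintegral do rewrite tE.
    rewrite (Rintegral_lincomb _ _ (fun n : 'I_N => hmi n)); apply: eq_bigr => n _.
    by rewrite mulrAC.
  rewrite /cosft -RintegralB //; last exact: integrable_cosft.
  by apply: eq_Rintegral => x _; rewrite dot_ray /r mulrBr.
have ri : mu.-integrable setT (EFin \o r).
  have := integrableB measurableT (integrable_cosft (ray t e) th hi) ti.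
  by apply: eq_integrable => // x _ /=; rewrite dot_ray /r mulrBr.
rewrite (le_trans (le_normr_Rintegral measurableT ri)) // /K.
rewrite -RintegralZr //; last exact: integrable_norm.
apply: le_Rintegral => //.
- exact: integrable_norm.
- by apply: (integrableZr measurableT _ (integrable_norm hi)).
- move=> x _; rewrite /r normrM; have [->|/hL hx] := eqVneq (h x) 0.
    by rewrite normr0 !mul0r.
  rewrite ler_wpM2l // (le_trans (cos_taylor_bound _ _ _)) //.
  have tM : `|t * dot x e| <= `|t| * M by rewrite normrM ler_wpM2l // dot_bound.
  by rewrite ler_wpM2r ?invr_ge0 // lerXn2r ?nnegrE // (le_trans _ tM).
Qed.

Lemma cosft_indep (f g : R3 -> R) L al : 
  integrable3 f -> integrable3 g -> supported_in L f -> supported_in L g ->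
  (forall n m : nat, n%:R != m%:R + al) ->
  (forall k th, 0 < euclid_norm k -> cosft f k th + euclid_norm k `^ al * cosft g k th = 0) ->
  forall k th, cosft f k th = 0 /\ cosft g k th = 0.
Proof.
move=> fi gi fL gL alN E.
suff H (k : R3) th : 0 < euclid_norm k -> forall t,
    cosft f (ray t k) th = 0 /\ cosft g (ray t k) th = 0.
  (* The origin lies on every ray, so [k = 0] is read off at parameter 0 along a unit vector. *)
  move=> k th; have := sqrtr_ge0 (dot k k); rewrite le_eqVlt => /orP[|k0].
    rewrite eq_sym sqrtr_eq0 => k0.
    have -> : k = ray 0 ((1, 0), 0).
      have : dot k k = k.1.1 ^+ 2 + k.1.2 ^+ 2 + k.2 ^+ 2 by rewrite /dot !expr2.
      case: k k0 => [[x y] z] /= k0 dE; rewrite /ray /= !mul0r.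
      have x2 := sqr_ge0 x; have y2 := sqr_ge0 y; have z2 := sqr_ge0 z.
      have [/eqP xx /eqP yy /eqP zz] : [/\ x ^+ 2 == 0, y ^+ 2 == 0 & z ^+ 2 == 0].
        by split; rewrite eq_le ?x2 ?y2 ?z2 andbT; lra.
      by move: xx yy zz => /eqP + /eqP + /eqP; rewrite !sqrf_eq0 => /eqP -> /eqP -> /eqP ->.
    by apply: H; rewrite /euclid_norm /dot /= !mul0r !addr0 mulr1 sqrtr1.
  have -> : k = ray 1 k by case: k {k0} => [[x y] z]; rewrite /ray /= !mul1r.
  exact: H.
move=> k0.
have [a [K [M ha]]] := cosft_expands k th fi fL.
have [b [K' [M' hb]]] := cosft_expands k th gi gL.
(* By homogeneity of the norm the weight on the ray is [t ^ al] times this constant. *)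
have c0 : euclid_norm k `^ al != 0 by rewrite powR_eq0 gt_eqF.
have [] := expands_order ha hb c0 alN.
  move=> t t0; have := E (ray t k) th; rewrite euclid_norm_ray ?(ltW t0) //.
  move=> <-; last exact: mulr_gt0.
  by rewrite powRM ?ltW // [_ `^ al * _ `^ al]mulrC.
by move=> p q t; split.
Qed.

End Rays.

(** * Injectivity of the Fourier transform *)

Lemma Rintegral_limit_eq0 d (T : measurableType d) (R : realType)
    (mu : {measure set T -> \bar R}) (f_ : nat -> T -> R) (f g : T -> R) :
  (forall n, measurable_fun setT (f_ n)) -> measurable_fun setT f ->
  mu.-integrable setT (EFin \o g) -> (forall n x, `|f_ n x| <= g x) ->
  (forall x, f_ n x @[n --> \oo] --> f x) ->
  (forall n, Rintegral mu setT (f_ n) = 0) -> Rintegral mu setT f = 0.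
Proof.
move=> mf_ mf gi fg cf I0.
have [] := @dominated_convergence _ T R mu setT measurableT
  (fun n => EFin \o f_ n) (EFin \o f) (EFin \o g).
- by move=> n; exact/measurable_EFinP.
- exact/measurable_EFinP.
- by apply: aeW => x _; apply: cvg_EFin; [exact: nearW|exact: cf].
- exact: gi.
- by apply: aeW => x n _ /=; rewrite lee_fin.
move=> _ _ c; rewrite /Rintegral.
have e0 n : (\int[mu]_x (f_ n x)%:E = 0)%E.
  have fi : mu.-integrable setT (EFin \o f_ n) by exact: integrable_le (fg n) gi.
  by rewrite -[LHS]fineK ?integrable_fin_num //; congr EFin; exact: I0.
have : (fun n => \int[mu]_x (EFin \o f_ n) x)%E @ \oo --> (0 : \bar R)%E.
  by under eq_fun do rewrite e0; exact: cvg_cst.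
by move=> /(cvg_unique _ c) ->.
Qed.

Lemma measurable_gt_set d (T : measurableType d) (R : realType) (f : T -> R) a :
  measurable_fun setT f -> measurable [set x | a < f x].
Proof.
move=> mf; rewrite -[X in measurable X]setTI.
have -> : [set x | a < f x] = f @^-1` `]a, +oo[%classic.
  by apply/seteqP; split => x; rewrite /= in_itv /= andbT.
exact: mf.
Qed.

Lemma indic_gtE (T : Type) (R : realType) (f : T -> R) a x :
  \1_[set x | a < f x] x = (a < f x)%R%:R :> R.
Proof. by rewrite indicE; congr (nat_of_bool _)%:R; apply/idP/idP; rewrite inE. Qed.

Section Bernoulli.
Variable R : realType.

Lemma bernoulli (x : R) n : -1 <= x -> 1 + n%:R * x <= (1 + x) ^+ n.
Proof.
move=> x1; elim: n => [|n IH]; first by rewrite mul0r addr0 expr0.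
rewrite exprS; apply: le_trans (_ : (1 + x) * (1 + n%:R * x) <= _).
  have : 0 <= n%:R * x ^+ 2 by rewrite mulr_ge0 ?sqr_ge0.
  rewrite -natr1 expr2 => h; lra.
by apply: ler_wpM2l => //; lra.
Qed.

(* Converges to 1 for [y < 1 / 2] and to 0 for [y > 1 / 2], boundedly on [0, 1]. *)
Definition threshold (n : nat) (y : R) : R := (1 - y ^+ n) ^+ (2 ^ n).

Lemma threshold_bound n (y : R) : 0 <= y <= 1 -> 0 <= threshold n y <= 1.
Proof.
move=> /andP[y0 y1].
have yn : 0 <= y ^+ n <= 1 by rewrite exprn_ge0 // exprn_ile1.
by rewrite exprn_ge0 ?exprn_ile1 //; lra.
Qed.

(** Bernoulli's inequality gives the lower bound [1 - (2 y)^n]. *)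
Lemma threshold_cvg1 (y : R) : 0 <= y < 1 / 2 -> threshold n y @[n --> \oo] --> (1 : R).
Proof.
move=> /andP[y0 y1].
have c0 : 1 - (2 * y) ^+ n @[n --> \oo] --> 1 - (0 : R).
  apply: cvgB; first exact: cvg_cst.
  by apply: cvg_expr; rewrite ger0_norm; lra.
rewrite subr0 in c0.
apply: squeeze_cvgr; [|exact: c0|exact: cvg_cst]; apply: nearW => n.
have yn : 0 <= y ^+ n <= 1 by rewrite exprn_ge0 // exprn_ile1 //; lra.
have /andP[_ ->] : 0 <= threshold n y <= 1 by apply: threshold_bound; lra.
rewrite andbT /threshold; have := @bernoulli (- y ^+ n) (2 ^ n)%N.
by rewrite exprMn natrX mulrN; apply; lra.
Qed.

(** Since [(1 - y^n) (1 + y^n) <= 1], the value is at most the inverse of [(1 + y^n)^(2^n)], which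
    Bernoulli's inequality bounds below by [(2 y)^n]. Such polynomials also serve in elementary
    proofs of the Stone-Weierstrass theorem. *)
Lemma threshold_cvg0 (y : R) : 1 / 2 < y <= 1 -> threshold n y @[n --> \oo] --> (0 : R).
Proof.
move=> /andP[y0 y1].
have y20 : 0 < 2 * y by lra.
have c0 : (2 * y)^-1 ^+ n @[n --> \oo] --> (0 : R).
  apply: cvg_expr; rewrite ger0_norm ?invr_ge0 ?ltW //.
  by rewrite invf_lt1 //; lra.
apply: squeeze_cvgr; [|exact: cvg_cst|exact: c0]; apply: nearW => n.
have yn : 0 <= y ^+ n <= 1 by rewrite exprn_ge0 ?exprn_ile1 //; lra.
have /andP[-> _] /= : 0 <= threshold n y <= 1 by apply: threshold_bound; lra.
have p0 : 0 < (2 * y) ^+ n by exact: exprn_gt0.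
rewrite exprVn -[leRHS]mul1r ler_pdivlMr // /threshold.
have b : (2 * y) ^+ n <= (1 + y ^+ n) ^+ (2 ^ n).
  have := @bernoulli (y ^+ n) (2 ^ n)%N; rewrite exprMn natrX.
  by move=> h; apply: le_trans (h _); lra.
apply: le_trans (_ : (1 - y ^+ n) ^+ (2 ^ n) * (1 + y ^+ n) ^+ (2 ^ n) <= _).
  by rewrite ler_wpM2l // exprn_ge0; lra.
rewrite -exprMn -subr_sqr expr1n exprn_ile1 //.
  by rewrite subr_ge0 exprn_ile1; lra.
by rewrite gerBl sqr_ge0.
Qed.

End Bernoulli.

Section FourierInjectivity.
Variable R : realType.
Local Notation mu := (@vol R).
Local Notation R3 := (Defs.space R).
Local Notation mR3 := (Defs.space (measurableTypeR R)).
Variable L : R.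

Definition ft_null (h : R3 -> R) :=
  [/\ integrable3 h, supported_in L h & forall k th, cosft h k th = 0].

(** These functions form an algebra that is closed under bounded pointwise limits and contains the
    cosines of linear forms. Hence it contains the indicators of half-spaces on the cube, and then
    those of all measurable sets. *)
Definition multiplier (p : mR3 -> R) :=
  [/\ measurable_fun setT p, exists M : R, forall x, `|p x| <= M
    & forall h, ft_null h -> ft_null (fun x => h x * p x)].

Let mul_int (h : R3 -> R) (p : mR3 -> R) : integrable3 h -> measurable_fun setT p ->
  (exists M : R, forall x, `|p x| <= M) -> integrable3 (fun x => h x * p x).
Proof. by move=> hi mp [M pM]; exact: (integrable_bmul hi mp pM). Qed.

Let mul_supp (h : R3 -> R) (p : mR3 -> R) : supported_in L h -> supported_in L (fun x => h x * p x).
Proof. by move=> hL x; rewrite mulf_eq0 negb_or => /andP[/hL]. Qed.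

Lemma multiplier_cst c : multiplier (fun=> c).
Proof.
split; [exact: measurable_cst|by exists (`|c|)|].
move=> h [hi hL h0]; split; [|exact: mul_supp|].
  by apply: mul_int => //; exists (`|c|).
move=> k th; rewrite /cosft -[RHS](mulr0 c) -(h0 k th) -RintegralZl //; last exact: integrable_cosft.
by apply: eq_Rintegral => x _; ring.
Qed.

Lemma multiplierD p q : multiplier p -> multiplier q -> multiplier (fun x => p x + q x).
Proof.
move=> [mp [M pM] hp] [mq [N qN] hq].
have mpq : measurable_fun setT (fun x => p x + q x) by exact: measurable_funD.
have bpq : exists M : R, forall x, `|p x + q x| <= M.
  by exists (M + N) => x; rewrite (le_trans (ler_normD _ _)) // lerD.
split => // h hV; have [hi hL h0] := hV.
have [pi _ p0] := hp _ hV; have [qi _ q0] := hq _ hV.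
split; [exact: mul_int|exact: mul_supp|].
move=> k th; rewrite -[RHS]addr0 -{1}(p0 k th) -(q0 k th) /cosft -RintegralD //; try exact: integrable_cosft.
by apply: eq_Rintegral => x _; ring.
Qed.

Lemma multiplierM p q : multiplier p -> multiplier q -> multiplier (fun x => p x * q x).
Proof.
move=> [mp [M pM] hp] [mq [N qN] hq].
split; first exact: measurable_funM.
  exists (M * N) => x; rewrite normrM ler_pM //.
by move=> h hV; have := hq _ (hp _ hV); under eq_fun do rewrite -mulrA.
Qed.

Lemma multiplierX p n : multiplier p -> multiplier (fun x => p x ^+ n).
Proof.
move=> hp; elim: n => [|n IH].
  by under eq_fun do rewrite expr0; exact: multiplier_cst.
by under eq_fun do rewrite exprS; exact: multiplierM.
Qed.

Lemma multiplierZ c p : multiplier p -> multiplier (fun x => c * p x).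
Proof. by move=> hp; apply: multiplierM => //; exact: multiplier_cst. Qed.

Lemma multiplier1B p : multiplier p -> multiplier (fun x => 1 - p x).
Proof.
move=> hp; under eq_fun do rewrite -mulN1r.
by apply: multiplierD; [exact: multiplier_cst|exact: multiplierZ].
Qed.

(** By the product-to-sum formula, multiplication by a cosine only shifts frequency and phase in the
    transform. *)
Lemma multiplier_cos (l : R3) ps : multiplier (fun x => cos (dot x l + ps)).
Proof.
have mc := measurable_cos_dot l ps.
have bc : exists M : R, forall x : mR3, `|cos (dot x l + ps) : R| <= M.
  by exists 1 => x; rewrite cos_max.
split => // h [hi hL h0]; split; [exact: mul_int|exact: mul_supp|].
move=> k th.
have i1 := integrable_cosft (l + k) (ps + th) hi.
have i2 := integrable_cosft (l - k) (ps - th) hi.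
have i12 := integrableD measurableT i1 i2.
transitivity (2^-1 * (cosft h (l + k) (ps + th) + cosft h (l - k) (ps - th))); last first.
  by rewrite !h0 addr0 mulr0.
rewrite /cosft -(RintegralD measurableT i1 i2) -(RintegralZl _ measurableT i12).
apply: eq_Rintegral => x _.
have -> : dot x (l + k) + (ps + th) = (dot x l + ps) + (dot x k + th) by rewrite /dot /=; ring.
have -> : dot x (l - k) + (ps - th) = (dot x l + ps) - (dot x k + th) by rewrite /dot /=; ring.
by move: (dot x l + ps) (dot x k + th) => a b; rewrite cosD cosB; field.
Qed.

Lemma multiplier_lim (p_ : nat -> mR3 -> R) (p : mR3 -> R) (M : R) :
  (forall n, multiplier (p_ n)) -> (forall n x, `|p_ n x| <= M) ->
  (forall x, p_ n x @[n --> \oo] --> p x) -> multiplier p.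
Proof.
move=> hp pM cp.
have mp : measurable_fun setT p.
  by apply: (@measurable_fun_cvg _ _ _ setT p_) => // n; case: (hp n).
have pM' x : `|p x| <= M.
  have c : `|p_ n x| @[n --> \oo] --> `|p x| by apply: cvg_norm; exact: cp.
  rewrite -(cvg_lim _ c) //.
  by apply: limr_le; [apply/cvg_ex; eexists; exact: c|exact: nearW].
split => //; first by exists M.
move=> h hV; have [hi hL h0] := hV.
have bp : exists M : R, forall x, `|p x| <= M by exists M.
split; [exact: mul_int|exact: mul_supp|] => k th.
have mh := integrable_measurable hi.
apply: (@Rintegral_limit_eq0 _ _ _ mu
  (fun n x => h x * p_ n x * cos (dot x k + th)) _ (fun x => M * `|h x|)).
- move=> n; apply: measurable_funM; last exact: measurable_cos_dot.
  by apply: measurable_funM => //; case: (hp n).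
- by apply: measurable_funM; [exact: measurable_funM|exact: measurable_cos_dot].
- by have := integrableZl measurableT M (integrable_norm hi); apply: eq_integrable.
- move=> n x; rewrite !normrM mulrAC mulrC; apply: le_trans (_ : `|p_ n x| * `|h x| <= _).
    by rewrite ler_wpM2l // ler_piMr // cos_max.
  by rewrite ler_wpM2r.
- move=> x; apply: cvgM; last exact: cvg_cst.
  by apply: cvgM; [exact: cvg_cst|exact: cp].
- by move=> n; have [_ _ /(_ h hV)[_ _ /(_ k th)]] := hp n.
Qed.

Lemma multiplier_eq_cube (p q : mR3 -> R) : multiplier p -> measurable_fun setT q ->
  (exists M : R, forall x, `|q x| <= M) -> (forall x, cube L x -> p x = q x) -> multiplier q.
Proof.
move=> [_ _ hp] mq bq pq; split => // h hV; have [_ hL _] := hV.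
have := hp _ hV; congr ft_null; apply/funext => x.
have [->|/hL hx] := eqVneq (h x) 0; first by rewrite !mul0r.
by rewrite pq.
Qed.


Lemma multiplier_neq0 (s : mR3 -> R) : multiplier s -> (forall x, `|s x| <= 1) ->
  multiplier (fun x => (s x != 0)%:R).
Proof.
move=> hs s1; apply: (@multiplier_lim (fun n x => 1 - (1 - s x ^+ 2) ^+ n) _ 1).
- by move=> n; apply/multiplier1B/multiplierX/multiplier1B/multiplierX.
- move=> n x; have s2 : 0 <= s x ^+ 2 <= 1.
    by rewrite sqr_ge0 /= -real_normK ?num_real // exprn_ile1.
  have : 0 <= (1 - s x ^+ 2) ^+ n <= 1 by rewrite exprn_ge0 ?exprn_ile1 //; lra.
  by rewrite ler_norml; lra.
- move=> x; have [->|s0] := eqVneq (s x) 0.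
    under eq_fun do rewrite expr0n subr0 expr1n subrr.
    exact: cvg_cst.
  rewrite -[X in _ --> X]subr0; apply: cvgB; first exact: cvg_cst.
  apply: cvg_expr.
  have s2 : 0 < s x ^+ 2 <= 1.
    by rewrite lt_def sqrf_eq0 s0 sqr_ge0 /= -real_normK ?num_real // exprn_ile1.
  by rewrite ger0_norm; lra.
Qed.

(** The map from [s] to [(1 - s) / 2] sends positive values below the threshold [1 / 2] and negative
    ones above it. Points with [s x = 0] land exactly on the threshold, where the limit is not 0;
    the factor [s x != 0] removes them. *)
Lemma multiplier_gt0 (s : mR3 -> R) : multiplier s -> (forall x, `|s x| <= 1) ->
  multiplier (fun x => (0 < s x)%R%:R).
Proof.
move=> hs s1.
have yb x : 0 <= 2^-1 * (1 - s x) <= 1 by have := s1 x; rewrite ler_norml; lra.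
apply: (@multiplier_lim (fun n x => (s x != 0)%:R * threshold n (2^-1 * (1 - s x))) _ 1).
- move=> n; apply: multiplierM; first exact: multiplier_neq0.
  by apply/multiplierX/multiplier1B/multiplierX/multiplierZ/multiplier1B.
- move=> n x; have /andP[t0 t1] := threshold_bound n (yb x).
  by case: eqP => _; rewrite ?mul0r ?normr0 // mul1r ger0_norm.
- move=> x; have := s1 x; rewrite ler_norml => sb; case: (ltgtP (s x) 0) => s0 /=.
  + under eq_fun do rewrite mul1r; by apply: threshold_cvg0; lra.
  + under eq_fun do rewrite mul1r; by apply: threshold_cvg1; lra.
  + under eq_fun do rewrite mul0r; exact: cvg_cst.
Qed.

Lemma sin_gt0_small (t : R) : `|t| < 1 -> (0 < sin t) = (0 < t).
Proof.
move=> t1; have pi1 := @pi_ge2 R.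
have p t' : 0 < t' < 1 -> 0 < sin t' :> R.
  by move=> /andP[h0 h1]; apply: sin_gt0_pi; lra.
move: t1; rewrite ltr_norml => t1.
have [t0|t0|<-] := ltgtP 0 t; last by rewrite sin0 ltxx.
  by rewrite p //; lra.
have : 0 < sin (- t) by apply: p; lra.
by rewrite sinN oppr_gt0 => /ltW st; rewrite ltNge st.
Qed.

(* [sin (c * (x_i - a))] has the sign of [x_i - a] on the cube for small [c]. *)
Lemma multiplier_halfspace (l : R3) (a : R) :
  [\/ l = ((1, 0), 0), l = ((0, 1), 0) | l = ((0, 0), 1)] ->
  multiplier (fun x => (a < dot x l)%R%:R).
Proof.
(* On the cube [dot x l - a] is at most [|L| + |a|] in absolute value; the added 1 makes the
   argument of the sine strictly smaller than 1. *)
move=> hl; pose c := (`|L| + `|a| + 1)^-1.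
have c0 : 0 < c by rewrite invr_gt0 ltr_wpDl // addr_ge0.
pose s (x : mR3) : R := sin (c * (dot x l - a)).
have hs : multiplier s.
  have := multiplier_cos (ray c l) (- (c * a) - pi / 2).
  by congr multiplier; apply/funext => x; rewrite /s dot_ray addrA cosBpihalf mulrBr.
apply: multiplier_eq_cube (multiplier_gt0 hs (fun x => sin_max _)) _ _ _.
- have md : measurable_fun [set: mR3] (fun x => dot x l : R).
    exact: measurable_dot.
  have -> : (fun x : mR3 => (a < dot x l)%R%:R : R) = \1_[set x : mR3 | a < dot x l].
    by apply/funext => x; rewrite indic_gtE.
  by apply: measurable_indic; exact: measurable_gt_set.
- by exists 1 => x; case: (a < dot x l); rewrite ?normr0 ?normr1.
- move=> x /cubeE[x1 x2 x3]; congr (nat_of_bool _)%:R; rewrite /s sin_gt0_small.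
    by rewrite pmulr_rgt0 // subr_gt0.
  have dl : `|dot x l| <= L.
    by case: hl => ->; rewrite /dot /= !mulr1 !mulr0 ?addr0 ?add0r.
  rewrite normrM gtr0_norm // /c mulrC ltr_pdivrMr ?mul1r; last by rewrite -invr_gt0.
  have := ler_norm L; have := ler_normB (dot x l) a; lra.
Qed.

Lemma sigma_algebra_multiplier :
  sigma_algebra setT [set E : set mR3 | measurable E /\ multiplier (\1_E)].
Proof.
split.
- split; first exact: measurable0.
  have := multiplier_cst 0; congr multiplier; apply/funext => x.
  by rewrite indicE in_set0.
- move=> E [mE hE]; split; first exact: measurableD.
  have := multiplier1B hE; congr multiplier; apply/funext => x.
  rewrite setTD !indicE in_setC; by case: (x \in E); rewrite /= ?subrr ?subr0.
- move=> E hE; split; first by apply: bigcupT_measurable => n; case: (hE n).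
  (* The indicator of the union of the first [n] sets, as a polynomial in their indicators. *)
  pose p_ n (x : mR3) : R := 1 - \prod_(i < n) (1 - \1_(E i) x).
  have b01 (A : set mR3) x : 0 <= (1 - \1_A x : R) <= 1.
    by rewrite indicE; case: (_ \in _) => /=; lra.
  apply: (@multiplier_lim p_ _ 1).
  + move=> n; apply: multiplier1B; elim: n => [|n IH].
      by under eq_fun do rewrite big_ord0; exact: multiplier_cst.
    under eq_fun do rewrite big_ord_recr /=; apply: multiplierM => //.
    by apply: multiplier1B; case: (hE n).
  + move=> n x; rewrite /p_.
    have : 0 <= (\prod_(i < n) (1 - \1_(E i) x) : R) <= 1.
      by apply/andP; split; [apply: prodr_ge0 => i _|apply: prodr_ile1 => i _];
        have := b01 (E i) x; case/andP.
    by rewrite ler_norml; lra.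
  + move=> x; rewrite indicE; have [/set_mem[m _ Em]|nx] := boolP (x \in _).
      apply: cvg_near_cst; near=> n.
      have mn : (m < n)%N by near: n; exact: nbhs_infty_gt.
      rewrite /p_ (bigD1 (Ordinal mn)) //= indicE mem_set // subrr mul0r subr0 //.
    apply: cvg_near_cst; apply: nearW => n; rewrite /p_ big1 ?subrr // => i _.
    rewrite indicE memNset ?subr0 // => Ei; case/negP: nx; apply/mem_set.
    by exists (i : nat).
Unshelve. all: end_near. Qed.

(** The sets with this property form a sigma-algebra, so it is enough to treat generators: preimages
    of open half-lines under the coordinates. The product is nested, hence the two successive
    reductions. *)
Lemma multiplier_measurable (E : set mR3) : measurable E -> multiplier (\1_E).
Proof.
pose S := [set E : set mR3 | measurable E /\ multiplier (\1_E)].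
have sS : sigma_algebra setT S by exact: sigma_algebra_multiplier.
suff H : measurable `<=` S by move=> /H[].
have half (l : R3) (f : mR3 -> measurableTypeR R) : measurable_fun setT f ->
    [\/ l = ((1, 0), 0), l = ((0, 1), 0) | l = ((0, 0), 1)] ->
    (forall x, f x = dot x l) -> forall A, measurable A -> S (f @^-1` A).
  move=> mf hl fE.
  have : measurable `<=` [set A | S (f @^-1` A)].
    rewrite RGenOInfty.measurableE; apply: smallest_sub.
      split.
      - by rewrite /= preimage_set0; case: sS.
      - by move=> A hA; rewrite /= setTD preimage_setC -setTD; case: sS => _ h _; exact: h.
      - by move=> A hA; rewrite /= preimage_bigcup; case: sS => _ _ h; exact: h.
    move=> _ [a ->]; split.
      by rewrite -[X in measurable X]setTI; apply: mf.
    have := multiplier_halfspace a hl; congr multiplier; apply/funext => x.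
    rewrite -indic_gtE; have -> // : f @^-1` `]a, +oo[%classic = [set x | a < dot x l].
    by apply/seteqP; split => y; rewrite /= in_itv /= andbT fE.
  by move=> h A /h.
have [m1 m2 m3] := measurable_coordinates R.
have h1 : forall A, measurable A -> S ((fun x : mR3 => x.1.1) @^-1` A).
  apply: (half ((1, 0), 0)); [|by constructor 1|by move=> x; rewrite /dot /= mulr1 !mulr0 !addr0].
  exact: m1.
have h2 : forall A, measurable A -> S ((fun x : mR3 => x.1.2) @^-1` A).
  apply: (half ((0, 1), 0)); [|by constructor 2|by move=> x; rewrite /dot /= mulr1 !mulr0 addr0 add0r].
  exact: m2.
have h3 : forall A, measurable A -> S ((fun x : mR3 => x.2) @^-1` A).
  apply: (half ((0, 0), 1)); [|by constructor 3|by move=> x; rewrite /dot /= mulr1 !mulr0 !add0r].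
  exact: m3.
apply: smallest_sub => //; rewrite subUset; split; last first.
  by move=> _ [A mA <-]; rewrite setTI; exact: h3.
move=> _ [A mA <-]; rewrite setTI; move: A mA.
suff : measurable `<=` [set A : set (measurableTypeR R * measurableTypeR R) | S (fst @^-1` A)] by [].
apply: smallest_sub.
  split.
  - by rewrite /= preimage_set0; case: sS.
  - by move=> A hA; rewrite /= setTD preimage_setC -setTD; case: sS => _ h _; exact: h.
  - by move=> A hA; rewrite /= preimage_bigcup; case: sS => _ _ h; exact: h.
rewrite subUset; split => _ [A mA <-]; rewrite setTI /=.
  exact: h1.
exact: h2.
Qed.

(** Multiplying by the indicators of [h > 0] and [h < 0] keeps the transform null; at frequency 0
    this says that the positive and the negative part of [h] have integral 0. *)
Lemma ft_null_ae0 h : ft_null h -> {ae mu, forall x, h x = 0}.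
Proof.
move=> hV; have [hi _ _] := hV; have mh := integrable_measurable hi.
have half (E : set mR3) (s : R) : measurable E -> (forall x, 0 <= s * (h x * \1_E x)) -> `|s| = 1 ->
    {ae mu, forall x, s * (h x * \1_E x) = 0}.
  move=> mE hE s1; have [_ _ /(_ h hV)[ii _ h0]] := multiplier_measurable mE.
  apply: Rintegral_eq0_ae => //.
    by apply: eq_integrable (integrableZl measurableT s ii).
  rewrite RintegralZl //; transitivity (s * cosft (fun x => h x * \1_E x) ((0, 0), 0) 0).
    congr (_ * _); apply: eq_Rintegral => x _.
    by rewrite /dot /= !mulr0 !addr0 cos0 mulr1.
  by rewrite h0 mulr0.
have mp : measurable [set x : mR3 | 0 < h x].
  exact: measurable_gt_set.
have mn : measurable [set x : mR3 | h x < 0].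
  have -> : [set x : mR3 | h x < 0] = [set x | 0 < - h x].
    by apply/seteqP; split => x /=; rewrite oppr_gt0.
  by apply: measurable_gt_set; exact: measurableT_comp.
have ap := half _ 1 mp; have an := half _ (-1) mn.
apply: ae_imply2 (ap _ (normr1 _)) (an _ (normrN1 _)).
- move=> x; rewrite !indicE mul1r mulN1r => hp hn.
  have [h0|h0|//] := ltgtP (h x) 0.
    by move/eqP: hn; rewrite mem_set // mulr1 oppr_eq0 => /eqP.
  by move: hp; rewrite mem_set // mulr1.
- move=> x; rewrite indicE mul1r; have [/set_mem|_] := boolP (x \in _).
    by rewrite mulr1 => /ltW.
  by rewrite mulr0.
- move=> x; rewrite indicE mulN1r; have [/set_mem|_] := boolP (x \in _).
    by rewrite mulr1 oppr_ge0 => /ltW.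
  by rewrite mulr0 oppr0.
Qed.

End FourierInjectivity.

(** * Momentum space *)

Section MomentumSpace.
Variable R : realType.
Local Notation mu := (@vol R).
Local Notation R3 := (Defs.space R).
Local Notation mR3 := (Defs.space (measurableTypeR R)).
Implicit Types (k : R3) (h f g : R3 -> R).

Lemma euclid_norm_ge0 k : 0 <= euclid_norm k.
Proof. exact: sqrtr_ge0. Qed.

Lemma euclid_norm_gt_coord k (r : R) :
  [\/ r < `|k.1.1|, r < `|k.1.2| | r < `|k.2|] -> r < euclid_norm k.
Proof.
have H (x : R) : x ^+ 2 <= dot k k -> r < `|x| -> r < euclid_norm k.
  by move=> xk rx; apply: lt_le_trans rx _; rewrite -sqrtr_sqr ler_wsqrtr.
have := sqr_ge0 k.1.1; have := sqr_ge0 k.1.2; have := sqr_ge0 k.2.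
by move=> h1 h2 h3; case; apply: H; rewrite /dot -!expr2; lra.
Qed.

Lemma euclid_norm_cube k (r : R) : euclid_norm k <= r -> cube r k.
Proof.
move=> kr; apply/cubeE; split; rewrite leNgt; apply/negP => h; move: kr;
  rewrite leNgt => /negP; apply; apply: euclid_norm_gt_coord.
- by constructor 1.
- by constructor 2.
- by constructor 3.
Qed.

Lemma continuous_euclid_norm : continuous (@euclid_norm R).
Proof.
move=> k; apply: continuous_comp; last exact: sqrt_continuous.
have c1 : {for k, continuous (fun k : R3 => k.1.1)}.
  by apply: continuous_comp; exact: cvg_fst.
have c2 : {for k, continuous (fun k : R3 => k.1.2)}.
  by apply: continuous_comp; [exact: cvg_fst|exact: cvg_snd].
have c3 : {for k, continuous (fun k : R3 => k.2)} by exact: cvg_snd.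
by apply: cvgD; [apply: cvgD|]; apply: cvgM.
Qed.

Lemma measurable_euclid_norm : measurable_fun [set: mR3] (@euclid_norm R : mR3 -> R).
Proof.
have [m1 m2 m3] := measurable_coordinates R.
have ms : measurable_fun [set: R] (@Num.sqrt R).
  by apply: continuous_measurable_fun; exact: sqrt_continuous.
have md : measurable_fun [set: mR3] (fun k => dot k k : R).
  by apply: measurable_funD; [apply: measurable_funD|]; apply: measurable_funM.
exact: (measurableT_comp ms md).
Qed.

Lemma measurable_norm_powR (p : R) :
  measurable_fun [set: mR3] (fun k => euclid_norm k `^ p : R).
Proof. by apply: (measurableT_comp (measurable_powR p)); exact: measurable_euclid_norm. Qed.

(** Among the dyadic cubes containing [k], the smallest works: outside the next one the norm exceeds
    [2^-(n+1)]. *)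
Lemma norm_powR_dyadic (s : R) k : 0 < s -> cube 1 k -> 0 < euclid_norm k ->
  exists2 n : nat, cube (2^-1 ^+ n) k & euclid_norm k `^ (- s) <= (2 ^+ n.+1) `^ s.
Proof.
move=> s0 k1 k0.
have half_lt : exists n, ~~ `[< cube (2^-1 ^+ n) k >].
  have c0 : 2^-1 ^+ n @[n --> \oo] --> (0 : R).
    by apply: cvg_expr; rewrite ger0_norm // invf_lt1 // ltr1n.
  have e0 : 0 < euclid_norm k / 2 by rewrite divr_gt0.
  have [n _ /(_ n (leqnn n)) hn] := cvgr_lt 0 c0 _ e0.
  exists n; apply/negP => /asboolP/cubeE[h1 h2 h3].
  have n0 : 0 <= 2^-1 ^+ n :> R by rewrite exprn_ge0 // invr_ge0.
  set z := 2^-1 ^+ n in hn h1 h2 h3 n0.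
  have sq (x : R) : `|x| <= z -> x ^+ 2 <= z ^+ 2.
    by move=> xz; rewrite -real_normK ?num_real // lerXn2r ?nnegrE.
  have : dot k k <= (2 * z) ^+ 2.
    have := sq _ h1; have := sq _ h2; have := sq _ h3.
    by rewrite exprMn /dot -!expr2; nra.
  move/ler_wsqrtr; rewrite sqrtr_sqr ger0_norm ?mulr_ge0 // -/(euclid_norm k); lra.
case: (ex_minnP half_lt) => -[|n] hn minn.
  by case/negP: hn; rewrite expr0; apply/asboolP.
exists n.
  by apply/asboolP/negPn/negP => /minn; rewrite ltnn.
have kn : 2^-1 ^+ n.+1 < euclid_norm k.
  rewrite ltNge; apply/negP => /euclid_norm_cube kc.
  by case/negP: hn; apply/asboolP.
rewrite powRN -[leRHS]invrK lef_pV2 ?posrE ?invr_gt0 ?powR_gt0 ?exprn_gt0 //.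
rewrite -powR_inv1 ?powR_ge0 // -powRrM mulrC powRrM powR_inv1 ?exprn_ge0 //.
by rewrite -exprVn; apply: ge0_ler_powR; rewrite ?nnegrE ?(ltW s0) ?(ltW k0) ?(ltW kn).
Qed.

(* The singularity at 0 is integrated over the dyadic cubes. *)
Lemma integrable_norm_powR_cube (s : R) : 0 < s < 3 ->
  integrable3 (fun k => euclid_norm k `^ (- s) * \1_(cube 1 : set mR3) k).
Proof.
move=> /andP[s0 s3].
pose c n : R := (2 ^+ n.+1) `^ s.
pose F n (k : mR3) : \bar R := (c n * \1_(cube (2^-1 ^+ n) : set mR3) k)%:E.
have mF n : measurable_fun setT (F n).
  apply/measurable_EFinP; apply: measurable_funM => //.
  by apply: measurable_indic; exact: measurable_cube.
have F0 n k : (0 <= F n k)%E.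
  by rewrite lee_fin mulr_ge0 ?powR_ge0 // indicE.
have IF n : (\int[mu]_k F n k = (c n * (2 * 2^-1 ^+ n) ^+ 3)%:E)%E.
  rewrite /F; under eq_integral do rewrite EFinM.
  rewrite ge0_integralZl //; last 2 first.
  - by apply/measurable_EFinP; apply: measurable_indic; exact: measurable_cube.
  - by rewrite lee_fin powR_ge0.
  rewrite integral_indic ?setIT; [|exact: measurableT|exact: measurable_cube].
  by rewrite vol_cube ?exprn_ge0 ?invr_ge0 // EFinM.
(* The ratio of consecutive dyadic contributions: the weight grows by [2^s] while the volume shrinks
   by 8, so the series converges because [s < 3]. *)
pose z : R := 2 `^ (s - 3).
have z0 : 0 < z by exact: powR_gt0.
have z1 : z < 1.
  rewrite /z /powR pnatr_eq0 /= -[X in _ < X]expR0 ltr_expR.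
  by rewrite pmulr_llt0 ?ln_gt0 ?ltr1n // subr_lt0.
have zE n : c n * (2 * 2^-1 ^+ n) ^+ 3 = (2 `^ s * 8) * z ^+ n.
  have cE : c n = (2 `^ s) ^+ n.+1.
    by rewrite /c -powR_mulrn // -powRrM mulrC powRrM powR_mulrn // powR_ge0.
  have -> : z = 2 `^ s / 8.
    rewrite /z powRB; last by apply/implyP => _; rewrite pnatr_eq0.
    by congr (_ / _); rewrite (powR_mulrn 3) //; ring.
  rewrite cE exprMn exprAC exprS [(_ / 8) ^+ n]exprMn.
  have -> : 2^-1 ^+ 3 = 8^-1 :> R by field.
  by move: (_ ^+ n) (8^-1 ^+ n) => u v; ring.
have PsiI : (\int[mu]_k \sum_(n <oo) F n k < +oo)%E.
  rewrite integral_nneseries //.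
  under eq_eseriesr do rewrite IF zE.
  have c1 : (fun N => \sum_(0 <= n < N) ((2 `^ s * 8) * z ^+ n)%:E)%E @ \oo --> ((2 `^ s * 8) / (1 - z))%:E.
    have -> : (fun N => \sum_(0 <= n < N) ((2 `^ s * 8) * z ^+ n)%:E)%E = EFin \o series (geometric (2 `^ s * 8) z).
      by apply/funext => N /=; rewrite /series /= -sumEFin.
    apply: cvg_EFin; first exact: nearW.
    by apply: cvg_geometric_series; rewrite ger0_norm // ltW.
  by rewrite (cvg_lim _ c1) // ltry.
have mG : measurable_fun [set: mR3] (fun k => euclid_norm k `^ (- s) * \1_(cube 1 : set mR3) k : R).
  apply: measurable_funM; first exact: measurable_norm_powR.
  by apply: measurable_indic; exact: measurable_cube.
apply/integrableP; split; first exact/measurable_EFinP.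
apply: le_lt_trans PsiI; apply: ge0_le_integral => //.
- by apply: measurableT_comp => //; exact/measurable_EFinP.
- have := ge0_emeasurable_sum (D := [set: mR3]) (h := F) (P := xpredT)
    (fun n k _ _ => F0 n k) (fun n _ => mF n).
  exact.
move=> k _ /=; rewrite ger0_norm ?mulr_ge0 ?powR_ge0 //.
rewrite indicE; have [/set_mem k1|_] := boolP (k \in _); last by rewrite mulr0; exact: nneseries_ge0.
have := euclid_norm_ge0 k; rewrite le_eqVlt => /orP[/eqP <-|k0].
  (* At the origin the negative power takes the conventional value 0. *)
  rewrite powR0 ?oppr_eq0 ?gt_eqF // mul0r; exact: nneseries_ge0.
have [n kn hn] := norm_powR_dyadic s0 k1 k0.
apply: le_trans (_ : F n k <= _)%E.
  by rewrite /F lee_fin indicE mem_set // !mulr1.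
apply: le_trans (nneseries_lim_ge n.+1 (fun n _ _ => F0 n k)).
by rewrite big_nat_recr //= leeDr // sume_ge0.
Qed.

End MomentumSpace.

(** * Sobolev products as inner products of weighted transforms *)

Section WeightedTransforms.
Variable R : realType.
Local Notation mu := (@vol R).
Local Notation R3 := (Defs.space R).
Local Notation mR3 := (Defs.space (measurableTypeR R)).
Implicit Types (r s : R) (k : R3) (h f g : R3 -> R).

Definition phase (b : bool) : R := if b then 0 else - (pi / 2).

(** Each factor of a Sobolev product receives half of the normalisation [(2 pi)^-3]. *)
Let c0 : R := Num.sqrt ((2 * pi) ^+ 3)^-1.

Let c0_gt0 : 0 < c0.
Proof. by rewrite sqrtr_gt0 invr_gt0 exprn_gt0 // mulr_gt0 // pi_gt0. Qed.

Let c0_sqr : c0 ^+ 2 = ((2 * pi) ^+ 3)^-1.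
Proof. by rewrite sqr_sqrtr // invr_ge0 exprn_ge0 // mulr_ge0 // pi_ge0. Qed.

(* [b] selects the real or the imaginary part. *)
Definition wft (r : R) h (b : bool) (k : mR3) : R :=
  c0 * euclid_norm k `^ r * cosft h k (phase b).

(** Unequal exponents [r] and [r'] are what lets the mixed term of order [- (1 - nu) / 2] become an
    inner product of a vector of exponent [- 3 / 2 + nu] with one of exponent [1 / 2]. At the origin
    the split of the exponent relies on [s != 0], since the power [0 ^ 0] is 1. *)
Lemma Re_sobolev_density s r r' h h' k : r + r' = 2 * s -> s != 0 ->
  complex.Re (sobolev_density s h h' k) =
  wft r h true k * wft r' h' true k + wft r h false k * wft r' h' false k.
Proof.
move=> rr s0; rewrite /sobolev_density.
have -> : fourier h k = (cosft h k 0 +i* cosft h k (- (pi / 2)))%C.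
  by rewrite -Re_fourier -Im_fourier; case: (fourier h k).
have -> : fourier h' k = (cosft h' k 0 +i* cosft h' k (- (pi / 2)))%C.
  by rewrite -Re_fourier -Im_fourier; case: (fourier h' k).
rewrite /= -rr powRD; last by apply/implyP; rewrite rr mulf_eq0 pnatr_eq0 (negbTE s0).
rewrite /wft /phase -c0_sqr; ring.
Qed.

Lemma Re_sobolev_prod s r r' h h' : r + r' = 2 * s -> s != 0 ->
  complex.Re (sobolev_prod s h h') = inner mu (wft r h) (wft r' h').
Proof.
move=> rr s0; rewrite /sobolev_prod /inner /=; apply: eq_Rintegral => k _.
exact: Re_sobolev_density.
Qed.

Lemma measurable_wft r h b : integrable3 h -> measurable_fun setT (wft r h b).
Proof.
move=> hi; apply: measurable_funM; last exact: measurable_cosft.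
by apply: measurable_funM => //; exact: measurable_norm_powR.
Qed.

Lemma sqint_wft s h : s != 0 -> homogeneous_sobolev s h -> sqint mu (wft s h).
Proof.
move=> s0 [hi di].
have {}di : mu.-integrable setT (EFin \o (fun k => wft s h true k ^+ 2 + wft s h false k ^+ 2)).
  congr (mu.-integrable _ (EFin \o _)): di; apply/funext => k.
  by rewrite (@Re_sobolev_density s s s) -?expr2 //; ring.
move=> b; split; first exact: measurable_wft.
apply: integrable_le di; first by apply: measurable_funX; exact: measurable_wft.
move=> k; rewrite ger0_norm ?sqr_ge0 //.
by case: b; rewrite ?lerDl ?lerDr sqr_ge0.
Qed.

(** Where the norm is at least 1, the exponent is below [- 1 / 2] and the density of order [- 1 / 2]
    dominates, by [nu < 1]. Near the origin the transform is bounded and [|k|^(-3 + 2 nu)] is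
    integrable, by [nu > 0]. *)
Lemma sqint_wft_infrared f (nu : R) : 0 < nu < 1 ->
  homogeneous_sobolev (- (1 / 2)) f -> sqint mu (wft (- (3 / 2) + nu) f).
Proof.
move=> /andP[nu0 nu1] fs b; have [fi _] := fs.
have [_ sE] : square_integrable mu (wft (- (1 / 2)) f b).
  by apply: sqint_wft => //; rewrite oppr_eq0; lra.
split; first exact: measurable_wft.
pose I := Rintegral mu setT (fun x => `|f x|).
have nu3 : 0 < 3 - 2 * nu < 3 by lra.
have sN := integrableZl measurableT ((c0 * I) ^+ 2) (integrable_norm_powR_cube nu3).
apply: integrable_le (integrableD measurableT sE sN).
  by apply: measurable_funX; exact: measurable_wft.
move=> k /=; rewrite ger0_norm ?sqr_ge0 //.
have N0 := euclid_norm_ge0 k.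
have [k1|k1] := leP 1 (euclid_norm k).
  apply: ler_wpDr.
    by rewrite mulr_ge0 ?sqr_ge0 // mulr_ge0 ?powR_ge0 // indicE.
  rewrite /wft !exprMn ler_wpM2r ?sqr_ge0 // ler_wpM2l ?sqr_ge0 //.
  rewrite lerXn2r ?nnegrE ?powR_ge0 //; apply: ler_powR => //; lra.
apply: ler_wpDl; first exact: sqr_ge0.
rewrite indicE mem_set ?mulr1; last exact: euclid_norm_cube (ltW k1).
have -> : euclid_norm k `^ (- (3 - 2 * nu)) = (euclid_norm k `^ (- (3 / 2) + nu)) ^+ 2.
  by rewrite -powR_mulrn ?powR_ge0 // -powRrM; congr (_ `^ _); lra.
rewrite /wft !exprMn mulrAC ler_wpM2r ?sqr_ge0 // ler_wpM2l ?sqr_ge0 //.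
rewrite -real_normK ?num_real // lerXn2r ?nnegrE ?Rintegral_ge0 //.
exact: cosft_bound.
Qed.

Lemma wft_lin (J : finType) (c : J -> R) (hs : J -> R3 -> R) r :
  (forall i, integrable3 (hs i)) ->
  wft r (fun x => \sum_i c i * hs i x) = lincomb c (fun i => wft r (hs i)).
Proof.
move=> hi; apply/funext => b; apply/funext => k.
by rewrite /wft cosft_lin // mulr_sumr; apply: eq_bigr => i _; ring.
Qed.

Lemma wft_ae0 r h : integrable3 h -> {ae mu, forall x, h x = 0} ->
  wft r h = fun _ _ => 0.
Proof.
move=> hi h0; apply/funext => b; apply/funext => k.
by rewrite /wft cosft_ae0 // mulr0.
Qed.

Lemma cosft_phase h k th : integrable3 h ->
  cosft h k th = cos th * cosft h k (phase true) - sin th * cosft h k (phase false).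
Proof.
move=> hi; have i1 := integrable_cosft k (phase true) hi.
have i2 := integrable_cosft k (phase false) hi.
rewrite /cosft -(RintegralZl (cos th) measurableT i1) -(RintegralZl (sin th) measurableT i2).
rewrite -RintegralB //; last 2 first.
- by apply: eq_integrable (integrableZl measurableT (cos th) i1).
- by apply: eq_integrable (integrableZl measurableT (sin th) i2).
by apply: eq_Rintegral => x _; rewrite /phase addr0 cosBpihalf cosD; ring.
Qed.

Lemma ae_continuous_eq0 (Phi : R3 -> R) (k0 : R3) :
  {ae mu, forall k, Phi k = 0} -> {for k0, continuous Phi} -> Phi k0 = 0.
Proof.
move=> [N [mN N0 PhiN]] cPhi; apply: contrapT => /eqP P0.
have [e /= e0 He] : exists2 e : R, 0 < e & ball k0 e `<=` [set k | Phi k != 0].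
  have : nbhs k0 [set k | Phi k != 0].
    exact: cvgr_neq0 cPhi P0.
  by move=> /nbhs_ballP[e e0 He]; exists e.
pose B : set mR3 := (`]k0.1.1 - e, k0.1.1 + e[%classic `*` `]k0.1.2 - e, k0.1.2 + e[%classic)
  `*` `]k0.2 - e, k0.2 + e[%classic.
have BN : B `<=` N.
  move=> k [[/= b1 b2] b3]; apply: PhiN => /= Pk; have := He k; rewrite /= Pk eqxx.
  move=> h; have // : false; apply: h.
  move: b1 b2 b3; rewrite /= !in_itv /= => b1 b2 b3.
  by split; [split|]; rewrite /ball /= ltr_norml; lra.
have mB : measurable B by do 2 (apply: measurableX => //).
have : (mu B <= mu N)%E by apply: le_measure => //; rewrite inE.
rewrite N0 /B volX // !lebesgue_measure_itv /= !lte_fin.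
have le (x : R) : x - e < x + e by lra.
rewrite !le -!EFinB -!EFinM lee_fin.
have d (x : R) : x + e - (x - e) = 2 * e by ring.
by rewrite !d leNgt !mulr_gt0.
Qed.

Lemma continuous_norm_powR (r : R) k0 : 0 < euclid_norm k0 ->
  {for k0, continuous (fun k : R3 => euclid_norm k `^ r)}.
Proof.
move=> k0p.
have cp : {for euclid_norm k0, continuous (fun x : R => x `^ r)}.
  apply: differentiable_continuous; apply/derivable1_diffP.
  by apply: derivable_powR; rewrite in_itv /= andbT.
by apply: (continuous_comp _ cp); exact: continuous_euclid_norm.
Qed.

(* The homogeneous weights differ by the non-integer power [2 - nu], so the two
   entire transforms can only cancel if both vanish. *)
Lemma wft_indep f g L (nu : R) : 0 < nu < 1 ->
  integrable3 f -> integrable3 g -> supported_in L f -> supported_in L g ->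
  {ae mu, forall k, forall b, wft (- (3 / 2) + nu) f b k + wft (1 / 2) g b k = 0} ->
  {ae mu, forall x, f x = 0} /\ {ae mu, forall x, g x = 0}.
Proof.
move=> /andP[nu0 nu1] fi gi fL gL H.
have E k b : 0 < euclid_norm k ->
    cosft f k (phase b) + euclid_norm k `^ (2 - nu) * cosft g k (phase b) = 0.
  move=> k0; have : wft (- (3 / 2) + nu) f b k + wft (1 / 2) g b k = 0.
    apply: (@ae_continuous_eq0 (fun k => wft (- (3 / 2) + nu) f b k + wft (1 / 2) g b k)).
      by apply: ae_imply H => x /(_ b).
    apply: cvgD; (apply: cvgM; last by apply: continuous_cosft; [|eassumption]);
      (apply: cvgM; [exact: cvg_cst|exact: continuous_norm_powR]).
  rewrite /wft -!mulrA -mulrDr => /eqP; rewrite mulf_eq0 (gt_eqF c0_gt0) /= => /eqP h.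
  have -> : euclid_norm k `^ (2 - nu) = euclid_norm k `^ (1 / 2) / euclid_norm k `^ (- (3 / 2) + nu).
    by rewrite -powRB; [congr (_ `^ _); lra|apply/implyP => _; rewrite gt_eqF].
  have w0 : euclid_norm k `^ (- (3 / 2) + nu) != 0 by rewrite powR_eq0 gt_eqF.
  by apply: (mulfI w0); rewrite mulr0 -[RHS]h; field.
suff H0 : forall k th, cosft f k th = 0 /\ cosft g k th = 0.
  by split; apply: (@ft_null_ae0 _ L); split => // k th; case: (H0 k th).
apply: (cosft_indep (L := L) (al := 2 - nu)) => //.
(* The number [m + 2 - nu] lies strictly between [m + 1] and [m + 2]. *)
- move=> n m; apply/eqP => nm.
  have h1 : (n < m + 2)%N by rewrite -(ltr_nat R) natrD; lra.
  have h2 : (m + 1 < n)%N by rewrite -(ltr_nat R) natrD; lra.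
  by move: h1 h2; rewrite addn2 addn1 ltnS => h1 h2; move: (leq_trans h2 h1); rewrite ltnn.
- move=> k th k0; rewrite (cosft_phase _ _ fi) (cosft_phase _ _ gi).
  have := E k true k0; have := E k false k0.
  move: (euclid_norm k `^ (2 - nu)) => w h1 h2.
  transitivity (cos th * (cosft f k (phase true) + w * cosft g k (phase true))
    - sin th * (cosft f k (phase false) + w * cosft g k (phase false))); first by ring.
  by rewrite h1 h2; ring.
Qed.

End WeightedTransforms.

(** * Modes and covariances *)

Section Modes.
Variable R : realType.
Local Notation mu := (@vol R).
Local Notation R3 := (Defs.space R).
Local Notation mR3 := (Defs.space (measurableTypeR R)).
Implicit Types (A B : 'I_2 -> observable R) (c : observable R).

Definition obs_lin (J : finType) (p : J -> R) (A : J -> observable R) : observable R :=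
  Observable (fun x => \sum_j p j * obs_g (A j) x)
             (fun x => \sum_j p j * obs_f (A j) x).

Definition integrable_obs c := integrable3 (obs_g c) /\ integrable3 (obs_f c).

Lemma in_phase_space_integrable c : in_phase_space c -> integrable_obs c.
Proof. by move=> [[gi _] [fi _]]. Qed.

Lemma integrable_obs_lin (J : finType) (p : J -> R) (A : J -> observable R) :
  (forall j, integrable_obs (A j)) -> integrable_obs (obs_lin p A).
Proof. by move=> hA; split; apply: integrable3_lin => j; case: (hA j). Qed.

Lemma sum_ord2 (F : 'I_2 -> R) : \sum_i F i = F 0 + F 1.
Proof. by rewrite !big_ord_recl big_ord0 addr0; congr (_ + F _); apply/val_inj. Qed.

(** The normalisation of the symplectic form enters the argument only through this non-vanishing. *)
Lemma single_mode_ae A : single_mode A ->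
  ~ {ae mu, forall x, obs_f (A 1) x * obs_g (A 0) x - obs_g (A 1) x * obs_f (A 0) x = 0}.
Proof.
move=> [hA _ w1] h0.
have mg i : measurable_fun setT (obs_g (A i) : mR3 -> R).
  by have [gi _] := in_phase_space_integrable (hA i); exact: integrable_measurable gi.
have mf i : measurable_fun setT (obs_f (A i) : mR3 -> R).
  by have [_ fi] := in_phase_space_integrable (hA i); exact: integrable_measurable fi.
have := ae_eq0_Rintegral _ h0 => /(_ _)/wrap[].
  by apply: measurable_funB; apply: measurable_funM.
have e1 : ord_max = 1 :> 'I_2 by apply/val_inj.
have e0 : ord0 = 0 :> 'I_2 by apply/val_inj.
by move: w1; rewrite /omega e1 e0 => -> /eqP; rewrite oner_eq0.
Qed.

(* Unless the [f] parts of a mode are linearly independent, a unimodular change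
   of generators makes one of them vanish; [e i = 1] marks the generators whose
   covariance grows with the Hubble rate. *)
Lemma single_mode_normal_form A : single_mode A ->
  exists (P : 'M[R]_2) (e : 'I_2 -> bool),
  [/\ \det P = 1, (0 < e 0%R + e 1%R)%N,
      forall i, ~~ e i -> {ae mu, forall x, obs_f (obs_lin (P i) A) x = 0}
    & forall d : 'I_2 -> R,
      {ae mu, forall x, \sum_i (d i * (e i)%:R) * obs_f (obs_lin (P i) A) x = 0} ->
      {ae mu, forall x, \sum_i (d i * (~~ e i)%:R) * obs_g (obs_lin (P i) A) x = 0} ->
      forall i, d i = 0].
Proof.
move=> hA; have hae := single_mode_ae hA.
have [ind|/existsNP[c /not_implyP[c0 /existsNP cn]]] := pselect (forall c : 'I_2 -> R,
    {ae mu, forall x, \sum_i c i * obs_f (A i) x = 0} -> forall i, c i = 0).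
  exists 1%:M, (fun=> true); split => //; first exact: det1.
  move=> d hd _; apply: ind; apply: ae_imply hd => x h; rewrite -[RHS]h; apply: eq_bigr => i _.
  rewrite mulr1 /= (bigD1 i) //= mxE eqxx mul1r big1 ?addr0 // => j ji.
  by rewrite mxE eq_sym (negbTE ji) mul0r.
pose n2 : R := c 0 ^+ 2 + c 1 ^+ 2.
have n20 : n2 != 0.
  apply/eqP => n0; case: cn => i; case.
  move: n0; rewrite /n2 => /eqP; rewrite paddr_eq0 ?sqr_ge0 // !sqrf_eq0 => /andP[/eqP z0 /eqP z1].
  by case: i => -[|[|//]] ip; [rewrite -[RHS]z0|rewrite -[RHS]z1]; congr c; apply/val_inj.
(* The first row is the relation [c] between the [f] parts, so the first new generator has no [f]
   part; the second row is orthogonal to it and scaled to make the determinant 1. *)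
pose P : 'M[R]_2 := \matrix_(i, j) (if i == 0 then c j else
  if j == 0 then - c 1 / n2 else c 0 / n2).
have f0E x : obs_f (obs_lin (P 0) A) x = c 0 * obs_f (A 0) x + c 1 * obs_f (A 1) x.
  by rewrite /= sum_ord2 !mxE.
have f1E x : obs_f (obs_lin (P 1) A) x = (- c 1 * obs_f (A 0) x + c 0 * obs_f (A 1) x) / n2.
  by rewrite /= sum_ord2 !mxE /=; ring.
have g0E x : obs_g (obs_lin (P 0) A) x = c 0 * obs_g (A 0) x + c 1 * obs_g (A 1) x.
  by rewrite /= sum_ord2 !mxE.
have f0 : {ae mu, forall x, obs_f (obs_lin (P 0) A) x = 0}.
  by apply: ae_imply c0 => x; rewrite sum_ord2 f0E.
exists P, (fun i => i != 0); split => //.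
- by rewrite det2E !mxE /= -[RHS](mulfV n20) {3}/n2; ring.
- by move=> i; rewrite negbK => /eqP ->.
move=> d hf hg.
(* Otherwise both new [f] parts vanish, hence both original ones, and with them the symplectic
   density. *)
have d1 : d 1 = 0.
  apply: contrapT => /eqP d1; apply: hae; apply: ae_imply2 f0 hf => x.
  rewrite f0E sum_ord2 f1E /= mulr0 mul0r add0r mulr1 => h0 /eqP.
  rewrite !mulf_eq0 (negbTE d1) invr_eq0 (negbTE n20) orbF /= => /eqP h1.
  have z0 : n2 * obs_f (A 0) x = 0.
    transitivity (c 0 * (c 0 * obs_f (A 0) x + c 1 * obs_f (A 1) x) -
      c 1 * (- c 1 * obs_f (A 0) x + c 0 * obs_f (A 1) x)); first by rewrite /n2; ring.
    by rewrite h0 h1 !mulr0 subr0.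
  have z1 : n2 * obs_f (A 1) x = 0.
    transitivity (c 1 * (c 0 * obs_f (A 0) x + c 1 * obs_f (A 1) x) +
      c 0 * (- c 1 * obs_f (A 0) x + c 0 * obs_f (A 1) x)); first by rewrite /n2; ring.
    by rewrite h0 h1 !mulr0 addr0.
  move/eqP: z0; rewrite mulf_eq0 (negbTE n20) => /eqP ->.
  move/eqP: z1; rewrite mulf_eq0 (negbTE n20) => /eqP ->.
  by rewrite mul0r mulr0 subr0.
(* Otherwise the first new generator is zero in both components, and the symplectic density of the
   two dependent generators vanishes. *)
have d0 : d 0 = 0.
  apply: contrapT => /eqP d0; apply: hae; apply: ae_imply2 f0 hg => x.
  rewrite f0E sum_ord2 g0E /= mulr0 mul0r addr0 mulr1 => h0 /eqP.
  rewrite mulf_eq0 (negbTE d0) /= => /eqP h1.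
  apply: (mulfI n20); rewrite mulr0.
  transitivity (c 0 * (obs_f (A 1) x * (c 0 * obs_g (A 0) x + c 1 * obs_g (A 1) x)
     - obs_g (A 1) x * (c 0 * obs_f (A 0) x + c 1 * obs_f (A 1) x))
     + c 1 * (obs_g (A 0) x * (c 0 * obs_f (A 0) x + c 1 * obs_f (A 1) x)
     - obs_f (A 0) x * (c 0 * obs_g (A 0) x + c 1 * obs_g (A 1) x))); first by rewrite /n2; ring.
  by rewrite h0 h1 !mulr0 !subrr !mulr0 addr0.
by case=> -[|[|//]] ip; [rewrite -[RHS]d0|rewrite -[RHS]d1]; congr d; apply/val_inj.
Qed.

Lemma compact_supp_cube (h : R3 -> R) : compact (supp h) ->
  exists L, forall L', L <= L' -> supported_in L' h.
Proof.
move=> /compact_bounded [M [Mr HM]]; exists (M + 1) => L' ML x hx.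
have xL : `|x| <= L'.
  by apply: HM; [rewrite (lt_le_trans _ ML) // ltrDl|exact: subset_closure].
by apply/cubeE; split; apply: le_trans xL; rewrite !prod_normE /= !le_max lexx ?orbT.
Qed.

Lemma modes_supported (J : finType) (hs : J -> R3 -> R) : (forall j, compact (supp (hs j))) ->
  exists L, forall j L', L <= L' -> supported_in L' (hs j).
Proof.
move=> hc; have [L hL] := choice (fun j => compact_supp_cube (hc j)).
exists (\sum_j `|L j|) => j L' LL'; apply: hL; apply: le_trans LL'.
rewrite (bigD1 j) //=; apply: ler_wpDr; last exact: ler_norm.
by apply: sumr_ge0.
Qed.

Lemma supported_lin (J : finType) (p : J -> R) (hs : J -> R3 -> R) L :
  (forall j, supported_in L (hs j)) -> supported_in L (fun x => \sum_j p j * hs j x).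
Proof.
move=> hL x; apply: contraNP => xL; apply/eqP; apply: big1 => j _.
have [->|/hL //] := eqVneq (hs j x) 0; by rewrite mulr0.
Qed.

Lemma region_out A x : ~ region A x ->
  (forall i, obs_g (A i) x = 0) /\ (forall i, obs_f (A i) x = 0).
Proof.
move=> xA; split => i; apply: contrapT => /eqP h; apply: xA; exists i => //.
  by left; exact: subset_closure.
by right; exact: subset_closure.
Qed.

End Modes.

(** * Changes of generators inside a mode, and the scaled limit of the form *)

Section LocalChange.
Variable R : realType.

Lemma det_block_congr (P Q A B C : 'M[R]_2) : \det P = 1 -> \det Q = 1 ->
  \det (block_mx (P *m A *m P^T) (P *m C *m Q^T) (P *m C *m Q^T)^T (Q *m B *m Q^T)) =
  \det (block_mx A C C^T B).
Proof.
move=> dP dQ; pose D := block_mx P 0 0 Q.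
have -> : block_mx (P *m A *m P^T) (P *m C *m Q^T) (P *m C *m Q^T)^T (Q *m B *m Q^T) =
    D *m block_mx A C C^T B *m D^T.
  rewrite /D tr_block_mx !trmx0 !mulmx_block !mul0mx !mulmx0 !addr0 !add0r.
  by rewrite !trmx_mul trmxK mulmxA.
by rewrite !det_mulmx det_tr det_ublock dP dQ !mul1r mulr1.
Qed.

(** A unimodular matrix of size two is symplectic: this is the invariance of the negativity
    criterion under local symplectic transformations. *)
Lemma local_invariance (P Q A B C : 'M[R]_2) : \det P = 1 -> \det Q = 1 ->
  let A' := P *m A *m P^T in let B' := Q *m B *m Q^T in let C' := P *m C *m Q^T in
  (let D := \det A' + \det B' - 2 * \det C' in
    2 <= D /\ D - 1 <= \det (block_mx A' C' C'^T B')) ->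
  let D := \det A + \det B - 2 * \det C in
    2 <= D /\ D - 1 <= \det (block_mx A C C^T B).
Proof.
move=> dP dQ A' B' C'.
have d1 (P' Q' M : 'M[R]_2) : \det P' = 1 -> \det Q' = 1 -> \det (P' *m M *m Q'^T) = \det M.
  by move=> dP' dQ'; rewrite !det_mulmx det_tr dP' dQ' mul1r mulr1.
by rewrite /A' /B' /C' det_block_congr // !d1.
Qed.

Lemma mx_bilinE (x y : 'rV[R]_2) (A : 'M[R]_2) :
  (x *m A *m y^T) 0 0 = \sum_i \sum_j x 0 i * y 0 j * A i j.
Proof.
rewrite exchange_big mxE; apply: eq_bigr => j _ /=.
by rewrite !mxE mulr_suml; apply: eq_bigr => i _; rewrite mulrAC.
Qed.

Lemma inner_scalel d (T : measurableType d) (mu : {measure set T -> \bar R})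
    (a : R) (U V : bool -> T -> R) : sqint mu U -> sqint mu V ->
  inner mu (fun b x => a * U b x) V = a * inner mu U V.
Proof.
move=> sU sV; rewrite /inner -(RintegralZl _ measurableT (sqint_inner sU sV)).
by apply: eq_Rintegral => x _; ring.
Qed.

Lemma inner0l d (T : measurableType d) (mu : {measure set T -> \bar R})
    (V : bool -> T -> R) : inner mu (fun _ _ => 0) V = 0.
Proof.
rewrite /inner (@eq_Rintegral _ _ _ mu setT (fun=> 0)) ?Rintegral_cst ?mul0r //.
by move=> x _; rewrite !mul0r addr0.
Qed.

(** Put [q = p^-1]. For each choice of [e] and [e'] the scaled expression is, for [p != 0], a
    polynomial in [p] whose constant term is the limit. The sign of [-1 * f] is that of the leading
    term of [g - q f]. *)
Lemma cvg_scaled_form d (T : measurableType d) (mu : {measure set T -> \bar R})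
    (e e' : bool) (g h f g' h' f' : bool -> T -> R) :
  sqint mu g -> sqint mu f -> sqint mu g' -> sqint mu f' ->
  (~~ e -> h = (fun _ _ => 0) /\ f = (fun _ _ => 0)) ->
  (~~ e' -> h' = (fun _ _ => 0) /\ f' = (fun _ _ => 0)) ->
  p ^+ e * p ^+ e' * (inner mu g g' + inner mu h h' + p^-1 ^+ 2 * inner mu f f'
    - p^-1 * (inner mu f g' + inner mu f' g)) @[p --> 0^'] -->
  inner mu (if e then (fun b x => -1 * f b x) else g)
           (if e' then (fun b x => -1 * f' b x) else g').
Proof.
move=> sg sf sg' sf' f0 f0'.
have nf : sqint mu (fun b x => -1 * f b x) by move=> b; exact: square_integrableZ.
have nf' : sqint mu (fun b x => -1 * f' b x) by move=> b; exact: square_integrableZ.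
have E2 : inner mu (fun b x => -1 * f b x) g' = - inner mu f g'.
  by rewrite inner_scalel // mulN1r.
have E3 : inner mu g (fun b x => -1 * f' b x) = - inner mu f' g.
  by rewrite innerC inner_scalel // mulN1r.
have E1 : inner mu (fun b x => -1 * f b x) (fun b x => -1 * f' b x) = inner mu f f'.
  by rewrite inner_scalel // innerC inner_scalel // innerC !mulN1r opprK.
have poly_cvg (W : R -> R) (a b l : R) : (forall p, p != 0 -> W p = a * p ^+ 2 + b * p + l) ->
    W p @[p --> 0^'] --> l.
  move=> WE; have c0 : (a *: 'X^2 + b *: 'X + l%:P).[p] @[p --> 0^'] --> (a *: 'X^2 + b *: 'X + l%:P).[0].
    by apply: cvg_within_filter; exact: continuous_horner.
  have l0 : (a *: 'X^2 + b *: 'X + l%:P).[0] = l by rewrite !(hornerD, hornerZ, hornerXn, hornerX, hornerC) expr0n /= !mulr0 !add0r.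
  rewrite l0 in c0; apply: cvg_trans c0; apply: near_eq_cvg; near=> p.
  have p0 : p != 0 by near: p; exact: nbhs_dnbhs_neq.
  by rewrite WE // !(hornerD, hornerZ, hornerXn, hornerX, hornerC).
case: e f0 => f0; case: e' f0' => f0'.
- rewrite E1; apply: (poly_cvg _ (inner mu g g' + inner mu h h') (- (inner mu f g' + inner mu f' g))) => p p0.
  by rewrite !expr1; field.
- have [-> ->] := f0' isT; rewrite E2 (innerC _ h) (innerC _ f (fun _ _ => 0)) !inner0l.
  by apply: (poly_cvg _ 0 (inner mu g g')) => p p0; rewrite expr1 expr0; field.
- have [-> ->] := f0 isT; rewrite E3 !inner0l.
  by apply: (poly_cvg _ 0 (inner mu g g')) => p p0; rewrite expr1 expr0; field.
- have [-> ->] := f0 isT; have [-> ->] := f0' isT; rewrite !inner0l.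
  by apply: (poly_cvg _ 0 0) => p p0; rewrite expr0; field.
Unshelve. all: end_near. Qed.

End LocalChange.

(** * The covariance metric as a bilinear form in weighted transforms *)

Section Covariance.
Variable R : realType.
Local Notation mu := (@vol R).
Local Notation R3 := (Defs.space R).
Local Notation mR3 := (Defs.space (measurableTypeR R)).
Implicit Types (A B : 'I_2 -> observable R) (c : observable R).
Variable nu : R.
Hypothesis nu01 : 0 < nu < 1.

Let G c := wft (1 / 2) (obs_g c).
Let E c := wft (- (1 / 2)) (obs_f c).
Let F c := wft (- (3 / 2) + nu) (obs_f c).

Definition cov (q : R) c c' : R :=
  inner mu (G c) (G c') + inner mu (E c) (E c') + q ^+ 2 * inner mu (F c) (F c')
  - q * (inner mu (F c) (G c') + inner mu (F c') (G c)).

Let congr_cov (a a' b b' k k' d d' l l' u u' : R) : a = a' -> b = b' -> k = k' ->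
    d = d' -> l = l' -> u = u' ->
  a + b + k * d - l * u = a' + b' + k' * d' - l' * u'.
Proof. by move=> -> -> -> -> -> ->. Qed.

Lemma BD_covarianceE m H c c' : musq m H = nu ->
  BD_covariance m H c c' = cov (kappa nu * H `^ (1 - nu)) c c'.
Proof.
move=> mE; have /andP[nu0 nu1] := nu01; rewrite /BD_covariance mE /cov.
apply: (congr_cov _ _ _ _ _ (congr2 +%R _ _)).
- by apply: Re_sobolev_prod; lra.
- by apply: Re_sobolev_prod; lra.
- rewrite [RHS]exprMn -(powR_mulrn 2 (powR_ge0 H (1 - nu))) -powRrM.
  by congr (_ * _ `^ _); ring.
- by apply: Re_sobolev_prod; lra.
- by [].
- by apply: Re_sobolev_prod; lra.
- by apply: Re_sobolev_prod; lra.
Qed.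

Definition finite_cov c :=
  [/\ integrable_obs c, sqint mu (G c), sqint mu (E c) & sqint mu (F c)].

Lemma in_phase_space_finite_cov c : in_phase_space c -> finite_cov c.
Proof.
move=> hc; have [hg hf] := hc; split.
- exact: in_phase_space_integrable.
- by apply: sqint_wft => //; lra.
- by apply: sqint_wft => //; lra.
- exact: sqint_wft_infrared.
Qed.

Section Lin.
Variables (J K : finType) (p : J -> R) (r : K -> R).
Variables (A : J -> observable R) (B : K -> observable R).
Hypothesis hA : forall j, finite_cov (A j).
Hypothesis hB : forall j, finite_cov (B j).

Lemma wft_obs_lin : [/\ G (obs_lin p A) = lincomb p (G \o A),
  E (obs_lin p A) = lincomb p (E \o A) & F (obs_lin p A) = lincomb p (F \o A)].
Proof. by split; apply: wft_lin => j; case: (hA j) => -[]. Qed.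

Lemma finite_cov_lin : finite_cov (obs_lin p A).
Proof.
have [gE eE fE] := wft_obs_lin; split.
- by apply: integrable_obs_lin => j; case: (hA j).
- by rewrite gE; apply: sqint_lincomb => j; case: (hA j).
- by rewrite eE; apply: sqint_lincomb => j; case: (hA j).
- by rewrite fE; apply: sqint_lincomb => j; case: (hA j).
Qed.

Lemma inner_lin2 (U V : observable R -> bool -> mR3 -> R) :
  (forall j, sqint mu (U (A j))) -> (forall j, sqint mu (V (B j))) ->
  inner mu (lincomb p (U \o A)) (lincomb r (V \o B)) =
  \sum_j \sum_k p j * r k * inner mu (U (A j)) (V (B k)).
Proof.
move=> sU sV.
have sUA j : sqint mu ((U \o A) j) by exact: sU.
have sVB k : sqint mu ((V \o B) k) by exact: sV.
rewrite (inner_lincombl _ sUA (sqint_lincomb _ sVB)).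
apply: eq_bigr => j _; rewrite (inner_lincombr _ sVB (sUA j)) mulr_sumr.
by apply: eq_bigr => k _; rewrite mulrA.
Qed.

End Lin.

Lemma cov_lin (J K : finType) (p : J -> R) (r : K -> R)
    (A : J -> observable R) (B : K -> observable R) q :
  (forall j, finite_cov (A j)) -> (forall j, finite_cov (B j)) ->
  cov q (obs_lin p A) (obs_lin r B) = \sum_j \sum_k p j * r k * cov q (A j) (B k).
Proof.
move=> hA hB; have [gA eA fA] := wft_obs_lin p hA; have [gB eB fB] := wft_obs_lin r hB.
have sGA j : sqint mu (G (A j)) by case: (hA j).
have sEA j : sqint mu (E (A j)) by case: (hA j).
have sFA j : sqint mu (F (A j)) by case: (hA j).
have sGB j : sqint mu (G (B j)) by case: (hB j).
have sEB j : sqint mu (E (B j)) by case: (hB j).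
have sFB j : sqint mu (F (B j)) by case: (hB j).
pose S (X : J -> K -> R) := \sum_j \sum_k p j * r k * X j k.
have SD X Y : S X + S Y = S (fun j k => X j k + Y j k).
  rewrite /S -big_split; apply: eq_bigr => j _ /=; rewrite -big_split.
  by apply: eq_bigr => k _ /=; rewrite mulrDr.
have SZ a X : a * S X = S (fun j k => a * X j k).
  rewrite /S mulr_sumr; apply: eq_bigr => j _; rewrite mulr_sumr.
  by apply: eq_bigr => k _; rewrite mulrCA.
have SC (U V : observable R -> bool -> mR3 -> R) :
    \sum_k \sum_j r k * p j * inner mu (U (B k)) (V (A j)) = S (fun j k => inner mu (U (B k)) (V (A j))).
  rewrite exchange_big; apply: eq_bigr => j _; apply: eq_bigr => k _ /=.
  by rewrite [r k * _]mulrC.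
rewrite /cov gA eA fA gB eB fB !inner_lin2 // SC.
transitivity (S (fun j k => inner mu (G (A j)) (G (B k)))
  + S (fun j k => inner mu (E (A j)) (E (B k)))
  + q ^+ 2 * S (fun j k => inner mu (F (A j)) (F (B k)))
  + - q * (S (fun j k => inner mu (F (A j)) (G (B k))) + S (fun j k => inner mu (F (B k)) (G (A j))))).
  by rewrite mulNr.
rewrite !(SD, SZ); apply: eq_bigr => j _; apply: eq_bigr => k _.
by rewrite mulNr.
Qed.

Lemma cov_mx_lin (P Q : 'M[R]_2) A B q :
  (forall j, finite_cov (A j)) -> (forall j, finite_cov (B j)) ->
  cov_mx (cov q) (fun i => obs_lin (P i) A) (fun i => obs_lin (Q i) B) =
  P *m cov_mx (cov q) A B *m Q^T.
Proof.
move=> hA hB; apply/matrixP => i j; rewrite mxE cov_lin // exchange_big mxE.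
apply: eq_bigr => l _; rewrite !mxE mulr_suml; apply: eq_bigr => k _.
by rewrite mxE mulrAC.
Qed.

(* The rescaled generator surviving in the limit of infinite Hubble rate. *)
Definition leading (e : bool) c : bool -> mR3 -> R :=
  if e then (fun b x => -1 * F c b x) else G c.

Lemma sqint_leading e c : finite_cov c -> sqint mu (leading e c).
Proof. by case=> _ sG _ sF; case: e => // b; exact: square_integrableZ. Qed.

Lemma cvg_scaled_cov (e e' : bool) c c' : finite_cov c -> finite_cov c' ->
  (~~ e -> {ae mu, forall x, obs_f c x = 0}) ->
  (~~ e' -> {ae mu, forall x, obs_f c' x = 0}) ->
  p ^+ e * p ^+ e' * cov p^-1 c c' @[p --> 0^'] -->
  inner mu (leading e c) (leading e' c').
Proof.
move=> [[_ fi] sG sE sF] [[_ fi'] sG' sE' sF'] f0 f0'.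
apply: cvg_scaled_form => //.
- by move=> he; split; apply: wft_ae0 => //; exact: f0.
- by move=> he; split; apply: wft_ae0 => //; exact: f0'.
Qed.

End Covariance.

(** * Independence of the leading vectors and eventual separability *)

Section Gram.
Variable R : realType.
Local Notation mu := (@vol R).
Local Notation R3 := (Defs.space R).
Local Notation mR3 := (Defs.space (measurableTypeR R)).
Implicit Types (A B : 'I_2 -> observable R).
Variable nu : R.
Hypothesis nu01 : 0 < nu < 1.

Definition lin_change (P : 'M[R]_2) A (i : 'I_2) : observable R := obs_lin (P i) A.

Lemma leading_indep (P Q : 'M[R]_2) (e e' : 'I_2 -> bool) A B :
  single_mode A -> single_mode B -> non_overlapping A B ->
  (forall d : 'I_2 -> R,
    {ae mu, forall x, \sum_i (d i * (e i)%:R) * obs_f (lin_change P A i) x = 0} ->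
    {ae mu, forall x, \sum_i (d i * (~~ e i)%:R) * obs_g (lin_change P A i) x = 0} ->
    forall i, d i = 0) ->
  (forall d : 'I_2 -> R,
    {ae mu, forall x, \sum_i (d i * (e' i)%:R) * obs_f (lin_change Q B i) x = 0} ->
    {ae mu, forall x, \sum_i (d i * (~~ e' i)%:R) * obs_g (lin_change Q B i) x = 0} ->
    forall i, d i = 0) ->
  forall d d' : 'I_2 -> R,
  {ae mu, forall k, forall b,
    lincomb d (fun i => leading nu (e i) (lin_change P A i)) b k +
    lincomb d' (fun i => leading nu (e' i) (lin_change Q B i)) b k = 0} ->
  (forall i, d i = 0) /\ (forall i, d' i = 0).
Proof.
move=> hA hB AB indA indB d d' H.
have [phA cA _] := hA; have [phB cB _] := hB.
have intA i : integrable_obs (lin_change P A i).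
  by apply: integrable_obs_lin => j; exact: in_phase_space_integrable.
have intB i : integrable_obs (lin_change Q B i).
  by apply: integrable_obs_lin => j; exact: in_phase_space_integrable.
pose O (j : 'I_2 + 'I_2) := match j with
  | inl i => lin_change P A i | inr i => lin_change Q B i end.
pose ee (j : 'I_2 + 'I_2) := match j with inl i => e i | inr i => e' i end.
pose dd (j : 'I_2 + 'I_2) := match j with inl i => d i | inr i => d' i end.
have intO j : integrable_obs (O j) by case: j.
(* The relation between the four leading vectors is collected into one pair [f], [g]; the sign
   compensates the [-1] in [leading]. *)
pose f (x : R3) := \sum_j (- (dd j * (ee j)%:R)) * obs_f (O j) x.
pose g (x : R3) := \sum_j (dd j * (~~ ee j)%:R) * obs_g (O j) x.
have fi : integrable3 f by apply: integrable3_lin => j; case: (intO j).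
have gi : integrable3 g by apply: integrable3_lin => j; case: (intO j).
have [L hL] : exists L, [/\ forall i, supported_in L (obs_g (A i)), forall i, supported_in L (obs_f (A i)),
    forall i, supported_in L (obs_g (B i)) & forall i, supported_in L (obs_f (B i))].
  have [L1 h1] := modes_supported (fun i => (cA i).1).
  have [L2 h2] := modes_supported (fun i => (cA i).2).
  have [L3 h3] := modes_supported (fun i => (cB i).1).
  have [L4 h4] := modes_supported (fun i => (cB i).2).
  exists (`|L1| + `|L2| + `|L3| + `|L4|).
  have n1 := ler_norm L1; have n2 := ler_norm L2; have n3 := ler_norm L3; have n4 := ler_norm L4.
  have m1 := normr_ge0 L1; have m2 := normr_ge0 L2; have m3 := normr_ge0 L3; have m4 := normr_ge0 L4.
  split => i; [apply: h1|apply: h2|apply: h3|apply: h4].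
  - by apply: le_trans n1 _; rewrite -!addrA lerDl !addr_ge0.
  - by apply: le_trans n2 _; rewrite -addrA addrAC lerDr !addr_ge0.
  - by apply: le_trans n3 _; rewrite addrAC lerDr !addr_ge0.
  - by apply: le_trans n4 _; rewrite lerDr !addr_ge0.
have [gAL fAL gBL fBL] := hL.
have fL : supported_in L f by apply: supported_lin => -[] i; exact: supported_lin.
have gL : supported_in L g by apply: supported_lin => -[] i; exact: supported_lin.
have [f0 g0] : {ae mu, forall x, f x = 0} /\ {ae mu, forall x, g x = 0}.
  apply: (wft_indep nu01 fi gi fL gL); apply: ae_imply H => k Hk b; rewrite -[RHS](Hk b).
  rewrite /f /g (wft_lin _ _ (fun j => (intO j).2)) (wft_lin _ _ (fun j => (intO j).1)).
  rewrite /lincomb -big_split big_sumType; congr (_ + _); apply: eq_bigr => i _ /=.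
    by rewrite /leading; case: (e i) => /=; ring.
  by rewrite /leading; case: (e' i) => /=; ring.
(* Every point lies outside one of the two regions, so the sums over the modes vanish separately
   once their total does. *)
have disj x : ~ region A x \/ ~ region B x.
  have [xA|] := pselect (region A x); last by left.
  by right => xB; have : (region A `&` region B) x by []; rewrite AB.
have fE x : f x = - (\sum_i (d i * (e i)%:R) * obs_f (lin_change P A i) x) -
    \sum_i (d' i * (e' i)%:R) * obs_f (lin_change Q B i) x.
  rewrite /f big_sumType -!sumrN; congr (_ + _); apply: eq_bigr => i _ /=;
  by rewrite mulNr.
have gE x : g x = \sum_i (d i * (~~ e i)%:R) * obs_g (lin_change P A i) x +
    \sum_i (d' i * (~~ e' i)%:R) * obs_g (lin_change Q B i) x.
  by rewrite /g big_sumType.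
have out (M : 'M[R]_2) (D : 'I_2 -> observable R) (a : 'I_2 -> R) x : ~ region D x ->
    \sum_i a i * obs_f (lin_change M D i) x = 0 /\ \sum_i a i * obs_g (lin_change M D i) x = 0.
  move=> /region_out[h1 h2]; split; apply: big1 => i _ /=.
    by rewrite big1 ?mulr0 // => j _; rewrite h2 mulr0.
  by rewrite big1 ?mulr0 // => j _; rewrite h1 mulr0.
split.
  apply: indA.
    apply: ae_imply f0 => x; rewrite fE; case: (disj x) => hx; first by have [] := out P A (fun i => d i * (e i)%:R) x hx.
    have [-> _] := out Q B (fun i => d' i * (e' i)%:R) x hx.
    by rewrite subr0 => /eqP; rewrite oppr_eq0 => /eqP.
  apply: ae_imply g0 => x; rewrite gE; case: (disj x) => hx; first by have [] := out P A (fun i => d i * (~~ e i)%:R) x hx.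
  by have [_ ->] := out Q B (fun i => d' i * (~~ e' i)%:R) x hx; rewrite addr0.
apply: indB.
  apply: ae_imply f0 => x; rewrite fE; case: (disj x) => hx; last by have [] := out Q B (fun i => d' i * (e' i)%:R) x hx.
  have [-> _] := out P A (fun i => d i * (e i)%:R) x hx.
  by rewrite oppr0 sub0r => /eqP; rewrite oppr_eq0 => /eqP.
apply: ae_imply g0 => x; rewrite gE; case: (disj x) => hx; last by have [] := out Q B (fun i => d' i * (~~ e' i)%:R) x hx.
by have [_ ->] := out P A (fun i => d i * (~~ e i)%:R) x hx; rewrite add0r.
Qed.

Lemma gram_block_pos (U V : 'I_2 -> bool -> mR3 -> R) :
  (forall i, sqint mu (U i)) -> (forall i, sqint mu (V i)) ->
  (forall d d' : 'I_2 -> R,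
    {ae mu, forall k, forall b, lincomb d U b k + lincomb d' V b k = 0} ->
    (forall i, d i = 0) /\ (forall i, d' i = 0)) ->
  let gram (X Y : 'I_2 -> bool -> mR3 -> R) : 'M[R]_2 := \matrix_(i, j) inner mu (X i) (Y j) in
  [/\ 0 < \det (gram U U), 0 < \det (gram V V),
      \det (gram U V) ^+ 2 < \det (gram U U) * \det (gram V V)
    & 0 < \det (block_mx (gram U U) (gram U V) (gram U V)^T (gram V V))].
Proof.
move=> sU sV ind gram; apply: posdef_block_det.
- by apply/matrixP => i j; rewrite !mxE innerC.
- by apply/matrixP => i j; rewrite !mxE innerC.
move=> x y xy.
pose W (j : 'I_2 + 'I_2) := match j with inl i => U i | inr i => V i end.
pose z (j : 'I_2 + 'I_2) := match j with inl i => x 0 i | inr i => y 0 i end.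
have sW j : sqint mu (W j) by case: j.
have zE b k : lincomb z W b k = lincomb (x 0) U b k + lincomb (y 0) V b k.
  by rewrite /lincomb big_sumType.
have -> : (row_mx x y *m block_mx (gram U U) (gram U V) (gram U V)^T (gram V V) *m (row_mx x y)^T) 0 0 =
    inner mu (lincomb z W) (lincomb z W).
  rewrite mul_row_block tr_row_mx mul_row_col !mulmxDl !addrA.
  rewrite [LHS]mxE [X in X + _]mxE [X in X + _ + _]mxE !mx_bilinE.
  rewrite (inner_lincombl _ sW (sqint_lincomb _ sW)) big_sumType /=.
  have E (F : bool -> mR3 -> R) : sqint mu F -> inner mu F (lincomb z W) =
      \sum_i x 0 i * inner mu F (U i) + \sum_i y 0 i * inner mu F (V i).
    by move=> sF; rewrite (inner_lincombr _ sW sF) big_sumType.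
  under [X in _ = X + _]eq_bigr => i _ do rewrite E // mulrDr !mulr_sumr.
  under [X in _ = _ + X]eq_bigr => i _ do rewrite E // mulrDr !mulr_sumr.
  rewrite !big_split /= !addrA.
  rewrite [X in _ = X + _]addrAC.
  congr (_ + _ + _ + _); apply: eq_bigr => i _; apply: eq_bigr => j _;
    by rewrite !mxE mulrA // innerC.
rewrite lt_def inner_ge0 andbT; apply/eqP => w0.
have [x0 y0] : (forall i, x 0 i = 0) /\ (forall i, y 0 i = 0).
  apply: ind; apply: ae_imply (inner_eq0 (sqint_lincomb _ sW) w0) => k hk b.
  by rewrite -zE.
have x00 : x = 0 by apply/rowP => i; rewrite mxE x0.
have y00 : y = 0 by apply/rowP => i; rewrite mxE y0.
by move: xy; rewrite x00 y00 eqxx.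
Qed.

Lemma cov_negativity_eq0 A B : single_mode A -> single_mode B -> non_overlapping A B ->
  \forall p \near 0^', log_negativity (cov nu p^-1) A B = 0.
Proof.
move=> hA hB AB.
have [P [e [dP e_gt0 fA indA]]] := single_mode_normal_form hA.
have [Q [e' [dQ e'_gt0 fB indB]]] := single_mode_normal_form hB.
have nA j : finite_cov nu (A j) by apply: in_phase_space_finite_cov => //; case: hA.
have nB j : finite_cov nu (B j) by apply: in_phase_space_finite_cov => //; case: hB.
pose A' := lin_change P A; pose B' := lin_change Q B.
have nA' i : finite_cov nu (A' i) by exact: finite_cov_lin.
have nB' i : finite_cov nu (B' i) by exact: finite_cov_lin.
pose U i := leading nu (e i) (A' i); pose V i := leading nu (e' i) (B' i).
have sU i : sqint mu (U i) by exact: sqint_leading.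
have sV i : sqint mu (V i) by exact: sqint_leading.
have [UU VV UV N] := gram_block_pos sU sV (leading_indep hA hB AB indA indB).
have c0 : (id p : R) @[p --> 0^'] --> 0 by apply: cvg_within_filter; exact: cvg_id.
have cn : \forall p \near (0 : R)^', id p != 0 by exact: nbhs_dnbhs_neq.
pose lead (X Y : 'I_2 -> bool -> mR3 -> R) : 'M[R]_2 := \matrix_(i, j) inner mu (X i) (Y j).
have cAA i j : scale_mx (id p) (fun i => e i) (fun i => e i)
    (cov_mx (cov nu p^-1) A' A') i j @[p --> 0^'] --> lead U U i j.
  rewrite [X in _ --> X]mxE; under eq_fun do rewrite 2!mxE.
  by apply: cvg_scaled_cov => //; exact: fA.
have cBB i j : scale_mx (id p) (fun i => e' i) (fun i => e' i)
    (cov_mx (cov nu p^-1) B' B') i j @[p --> 0^'] --> lead V V i j.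
  rewrite [X in _ --> X]mxE; under eq_fun do rewrite 2!mxE.
  by apply: cvg_scaled_cov => //; exact: fB.
have cAB i j : scale_mx (id p) (fun i => e i) (fun i => e' i)
    (cov_mx (cov nu p^-1) A' B') i j @[p --> 0^'] --> lead U V i j.
  rewrite [X in _ --> X]mxE; under eq_fun do rewrite 2!mxE.
  by apply: cvg_scaled_cov => //; [exact: fA|exact: fB].
apply: filterS (det_asymptotics c0 cn e_gt0 e'_gt0 cAA cBB cAB UU UV N) => p.
rewrite !cov_mx_lin // => h; have [h1 h2] := local_invariance dP dQ h.
exact: log_negativity_eq0.
Qed.

End Gram.

Lemma dnbhs0_bound (R : realType) (Pr : R -> Prop) : (\forall p \near 0^', Pr p) ->
  exists2 d : R, 0 < d & forall p, p != 0 -> `|p| < d -> Pr p.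
Proof.
move=> /nbhs_ballP[d d0 H]; exists d => // p p0 pd; apply: H => //.
by rewrite /ball /= sub0r normrN.
Qed.

Unset Implicit Arguments.

Theorem proposition5 (R : realType) :
  exists2 eps : R, 0 < eps &
  forall (A B : 'I_2 -> observable R) (mu2 : R) (m : R -> R),
    single_mode A -> single_mode B -> non_overlapping A B ->
    0 < mu2 < eps ->
    (forall H : R, 0 < H -> 0 < m H /\ musq (m H) H = mu2) ->
    exists2 H0 : R, 0 < H0 &
    forall H1 H2 : R, H0 <= H1 -> H1 <= H2 ->
      log_negativity (BD_covariance (m H2) H2) A B
      <= log_negativity (BD_covariance (m H1) H1) A B.
Proof.
(* Any [mu2] strictly between 0 and 1 makes [2 - mu2] a non-integer and the infrared weight square
   integrable near 0. *)
exists 1; first exact: ltr01.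
move=> A B mu2 m hA hB AB mu01 hm.
have /andP[mu0 mu1] := mu01.
have covE H : 0 < H ->
    BD_covariance (m H) H = cov mu2 (kappa mu2 * H `^ (1 - mu2)) :> (observable R -> observable R -> R).
  move=> H0; apply/funext => c; apply/funext => c'.
  by apply: BD_covarianceE => //; case: (hm H H0).
have le_eq2 (a b c : R) : a = c -> b = c -> a <= b by move=> -> ->.
have [k0|k0] := eqVneq (kappa mu2) 0.
  have cst H : 1 <= H -> log_negativity (BD_covariance (m H) H) A B = log_negativity (cov mu2 0) A B.
    move=> H1; rewrite (covE H (lt_le_trans ltr01 H1)) k0 (mul0r (H `^ (1 - mu2))).
    reflexivity.
  exists 1; first exact: ltr01.
  by move=> H1 H2 H11 H12; exact: (le_eq2 _ _ _ (cst H2 (le_trans H11 H12)) (cst H1 H11)).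
have [d d0 hd] := dnbhs0_bound (cov_negativity_eq0 mu01 hA hB AB).
have kd : 0 < (`|kappa mu2| * d)^-1 by rewrite invr_gt0 mulr_gt0 // normr_gt0.
(* Solves [H^(1 - mu2) = (|kappa| d)^-1 + 1]; the added 1 makes [|q| > d^-1], that is [|p| < d],
   strict from [H0] on. *)
pose H0 := ((`|kappa mu2| * d)^-1 + 1) `^ (1 - mu2)^-1.
have H00 : 0 < H0 by rewrite powR_gt0 // addr_gt0.
have LN0 H : H0 <= H -> log_negativity (BD_covariance (m H) H) A B = 0.
  move=> H0H; have Hp : 0 < H by exact: lt_le_trans H0H.
  rewrite (covE H Hp) -(invrK (kappa mu2 * H `^ (1 - mu2))); set w := kappa mu2 * H `^ (1 - mu2).
  have w0 : w != 0 by rewrite mulf_neq0 // powR_eq0 gt_eqF.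
  apply: hd; first by rewrite invr_eq0.
  have Hb : (`|kappa mu2| * d)^-1 + 1 <= H `^ (1 - mu2).
    have -> : (`|kappa mu2| * d)^-1 + 1 = H0 `^ (1 - mu2).
      rewrite /H0 -powRrM mulVf ?powRr1 //; first by rewrite addr_ge0 // ltW.
      by rewrite gt_eqF // subr_gt0.
    apply: ge0_ler_powR; rewrite ?nnegrE ?subr_ge0 //; exact: ltW.
  rewrite normfV invf_plt ?posrE ?normr_gt0 // /w normrM (ger0_norm (powR_ge0 _ _)).
  have -> : d^-1 = `|kappa mu2| * (`|kappa mu2| * d)^-1.
    by rewrite invfM mulrA mulfV ?mul1r // normr_eq0.
  by rewrite ltr_pM2l ?normr_gt0 //; lra.
exists H0; first exact: H00.
move=> H1 H2 H01 H12.
exact: (le_eq2 _ _ _ (LN0 H2 (le_trans H01 H12)) (LN0 H1 H01)).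
Qed.
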